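(* Let $g\ge 0$ be a fixed integer, put $m=g+1$, and let $\mathcal{P}$ be any family of probability distributions on $\mathcal{X}\times\mathcal{Y}$ containing all purely discontinuous (i.e. purely atomic) distributions on $\mathcal{X}\times\mathcal{Y}$, such that for every $P\in\mathcal{P}$ the function $\Phi$ is $P^{\otimes(g+1)}$-almost surely bounded. Assume that, over $\mathcal{P}$, the regular parameter $\kappa_c$ has degree exactly $2m-c=2g+2-c$ for each $1\le c\le g+1$, and the regular parameter $\Delta^2$ has degree exactly $2m=2g+2$. Let $Z_1,Z_2,\dots$ be independent with distribution $P\in\mathcal{P}$. For $n\ge 2g+2$ let $\widehat{\Delta}=\widehat{\Delta}_n$ and $\hat v=\hat v_n$ be the statistics computed from $Z_1,\dots,Z_n$ defined in the context. (i) If $n\ge 2g+2$, then $\hat v$ has least variance among all unbiased estimators of $\mathbb{V}(\widehat{\Delta})$ over $\mathcal{P}$. That is, $\mathbb{E}_{P^{\otimes n}}(\hat v)=\mathbb{V}_{P^{\otimes n}}(\widehat{\Delta})$ for all $P\in\mathcal{P}$, and for every statistic $T=T(Z_1,\dots,Z_n)$ with $\mathbb{E}_{P^{\otimes n}}(T)=\mathbb{V}_{P^{\otimes n}}(\widehat{\Delta})$ for all $P\in\mathcal{P}$ one has $\mathbb{V}_{P^{\otimes n}}(\hat v)\le \mathbb{V}_{P^{\otimes n}}(T)$ for all $P\in\mathcal{P}$. (ii) For every $P\in\mathcal{P}$ and every real $d$ with $0\le d\le 2$, $n^{d/2}\bigl(\hat v_n-\mathbb{V}(\widehat{\Delta}_n)\bigr)\to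 0$ almost surely as $n\to\infty$ (with $g$ fixed).
   Context: Setting. $\mathcal{X}=\mathbb{R}^{r-1}$ is the predictor space, $\mathcal{Y}\subset\mathbb{R}$ the response space, and all distributions $P$ considered on $\mathcal{X}\times\mathcal{Y}\subset\mathbb{R}^r$ have discrete marginal on $\mathcal{Y}$. $L:\mathcal{Y}\times\mathcal{Y}\to\mathbb{R}$ is a measurable loss function. $M,M'$ are two deterministic learning algorithms, given by measurable functions $f_M,f_{M'}:(\mathcal{X}\times\mathcal{Y})^{g}\times\mathcal{X}\to\mathcal{Y}$ symmetric in the first $g$ arguments. For $z_i=(x_i,y_i)$, $$\Phi(z_1,\dots,z_g;z_{g+1})=L(f_M(z_1,\dots,z_g;x_{g+1}),y_{g+1})-L(f_{M'}(z_1,\dots,z_g;x_{g+1}),y_{g+1}),$$ $$\Phi_0(z_1,\dots,z_{g+1})=\frac1{g+1}\sum_{i=1}^{g+1}\Phi(z_1,\dots,z_{i-1},z_{i+1},\dots,z_{g+1};z_i).$$ Put $\Delta=\mathbb{E}_{P^{\otimes(g+1)}}(\Phi)=\mathbb{E}(\Phi_0)$ and $m=g+1$. U-statistics. For a (not necessarily symmetric) measurable function $\Psi$ of $k\le n$ arguments, the U-statistic associated to its symmetrization is the average of $\Psi(Z_{i_1},\dots,Z_{i_k})$ over all ordered $k$-tuples $(i_1,\dots,i_k)$ of pairwise distinct indices in $\{1,\dots,n\}$. $\widehat{\Delta}=\binom{n}{g+1}^{-1}\sum_{S}\Phi_0((Z_i)_{i\in S})$, the sum over all $(g+1)$-element subsets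 $S\subset\{1,\dots,n\}$, is the U-statistic with kernel $\Phi_0$; $\mathbb{V}(\widehat\Delta)$ denotes its variance under $P^{\otimes n}$. Regular parameters. A real parameter $\Theta(P)$, defined for $P$ in a family $\mathcal{P}$, is regular if for some $k$ there is a measurable symmetric function $\Psi_0$ of $k$ arguments with $\Theta(P)=\int\cdots\int\Psi_0(z_1,\dots,z_k)\,dP(z_1)\cdots dP(z_k)$ for all $P\in\mathcal{P}$; its degree is the smallest such $k$. For $1\le c\le m$, $$\kappa_c=\int\cdots\int\Phi_0(z_1,\dots,z_m)\,\Phi_0(z_{m-c+1},\dots,z_{2m-c})\,dP(z_1)\cdots dP(z_{2m-c}),$$ $$\Delta^2=\int\cdots\int\Phi_0(z_1,\dots,z_m)\,\Phi_0(z_{m+1},\dots,z_{2m})\,dP(z_1)\cdots dP(z_{2m}).$$ Variance estimator. $\widehat{\kappa_c}$ (based on $2m-c$ arguments) and $\widehat{\Delta^2}$ (based on $2m$ arguments) are the U-statistics from $Z_1,\dots,Z_n$ associated to the symmetrizations of the integrands in the two formulas above. With $\alpha_c=\binom{m}{c}\binom{n-m}{m-c}/\binom{n}{m}$ (the hypergeometric mass function of $\mathcal{H}(n,m,m)$ at $c$), $$\hat v=\sum_{c=1}^{m}\alpha_c\,\widehat{\kappa_c}-(1-\alpha_0)\,\widehat{\Delta^2}.$$ *)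

(* Defs.v *)
From HB Require Import structures.
From mathcomp Require Import all_boot all_order all_algebra all_fingroup.
From mathcomp Require Import all_classical all_reals all_analysis.

Set Implicit Arguments.
Unset Strict Implicit.
Unset Printing Implicit Defensive.

Import Order.TTheory GRing.Theory Num.Theory.
Import numFieldNormedType.Exports.

Local Open Scope classical_set_scope.
Local Open Scope ring_scope.

(* A nonempty set Y of reals, as a type.  Nonemptiness is required because
   measurableType extends pointedType; the chosen point plays no role. *)
Definition subreal (R : realType) (Y : set R) (Y0 : Y !=set0) : Type :=
  set_type Y.

HB.instance Definition _ (R : realType) (Y : set R) (Y0 : Y !=set0) :=
  Choice.copy (subreal Y0) (set_type Y).
HB.instance Definition _ (R : realType) (Y : set R) (Y0 : Y !=set0) :=
  isPointed.Build (subreal Y0)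
    (SigSub (mem_set (projT2 (cid Y0))) : subreal Y0).

Definition subreal_val (R : realType) (Y : set R) (Y0 : Y !=set0) :
  subreal Y0 -> R := val.

(* Y with the trace of the Borel sigma-algebra of R *)
Notation response Y0 := (g_sigma_algebra_preimageType (subreal_val (Y0 := Y0))).

Notation predictor R r := ((r.-1).-tuple R%type).

Section iid_law.
Context d (T : measurableType d) (R : realType).

Definition tcons n (x : T * n.-tuple T) : n.+1.-tuple T := [tuple of x.1 :: x.2].

Lemma measurable_tcons n : measurable_fun [set: T * n.-tuple T] (@tcons n).
Proof. exact: (measurable_cons measurable_fst measurable_snd). Qed.

HB.instance Definition _ n :=
  isMeasurableFun.Build _ _ _ _ (@tcons n) (@measurable_tcons n).

Variable P : probability T R.

(* the n-fold product of P with itself *)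
Fixpoint iid_law n : probability (n.-tuple T) R :=
  match n with
  | 0 => dirac [tuple]
  | n'.+1 => distribution (P \x iid_law n')%E (@tcons n')
  end.

Lemma iid_law_box n (A : 'I_n -> set T) : (forall i, measurable (A i)) ->
  iid_law n [set z | forall i, A i (tnth z i)] = (\prod_(i < n) P (A i))%E.
Proof.
elim: n A => [|n IH] A mA.
  by rewrite big_ord0 /= diracE mem_set// => -[].
rewrite big_ord_recl /= /distribution /pushforward.
set B := [set z : n.-tuple T | forall i, A (lift ord0 i) (tnth z i)].
have mB : measurable B.
  have -> : B = \bigcap_i ((fun z : n.-tuple T => tnth z i) @^-1` A (lift ord0 i)).
    by apply/seteqP; split=> z Hz i //=; apply: Hz.
  apply: fin_bigcap_measurable => // i _.
  by rewrite -[X in measurable X]setTI; exact: measurable_tnth.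
rewrite -(IH (fun i => A (lift ord0 i)))// -product_measure1E//.
congr (product_measure1 _ _ _); apply/seteqP; split=> -[x z] /=.
  move=> Hz; split; first exact: (Hz ord0).
  by move=> i; have := Hz (lift ord0 i); rewrite tnthS.
move=> [Ax Bz] i; case: (unliftP ord0 i) => [k|] -> //=.
by rewrite tnthS; exact: Bz.
Qed.

End iid_law.

Section atomic.
Context d (T : measurableType d) (R : realType).

(* purely atomic: carried by a countable set *)
Definition purely_discontinuous (mu : set T -> \bar R) : Prop :=
  exists C : set T, [/\ countable C, measurable C & mu (~` C) = 0%E].

End atomic.

Section independence.
Context d d' (Omega : measurableType d) (T : measurableType d') (R : realType).

Definition mutually_independent (Q : probability Omega R)
    (Z : nat -> Omega -> T) : Prop :=
  forall (J : seq nat) (A : nat -> set T), uniq J ->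
    (forall i, measurable (A i)) ->
    Q (\bigcap_(i in [set` J]) (Z i @^-1` A i)) =
      (\prod_(i <- J) Q (Z i @^-1` A i))%E.

(* Z 0 is the first observation *)
Definition iid (P : probability T R) (Q : probability Omega R)
    (Z : nat -> Omega -> T) : Prop :=
  [/\ forall i, measurable_fun [set: Omega] (Z i),
      forall i (A : set T), measurable A -> Q (Z i @^-1` A) = P A &
      mutually_independent Q Z].

End independence.

Definition subtuple (T : Type) k n (s : 'I_k -> 'I_n) (z : n.-tuple T) :
  k.-tuple T := [tuple tnth z (s i) | i < k].

Section ustatistics.
Context (R : realType) (T : Type).

(* U-statistic of the symmetrization of Psi: average of Psi over the ordered
   k-tuples of pairwise distinct indices *)
Definition Ustat k n (Psi : k.-tuple T -> R) (z : n.-tuple T) : R :=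
  (#|[pred s : {ffun 'I_k -> 'I_n} | injectiveb s]|%:R)^-1 *
  \sum_(s : {ffun 'I_k -> 'I_n} | injectiveb s) Psi (subtuple s z).

(* (z_i)_(i in S) for a k-element set S of indices, listed increasingly *)
Definition subsample k n (S : {S : {set 'I_n} | #|S| == k}) (z : n.-tuple T) :
    k.-tuple T :=
  subtuple (fun i => enum_val (cast_ord (esym (eqP (valP S))) i)) z.

(* U-statistic with a symmetric kernel *)
Definition Ustat_sym k n (Psi : k.-tuple T -> R) (z : n.-tuple T) : R :=
  ('C(n, k)%:R)^-1 *
  \sum_(S : {S : {set 'I_n} | #|S| == k}) Psi (subsample S z).

(* For c <= m, the function Psi(z_1,...,z_m) Psi(z_(m-c+1),...,z_(2m-c)) of
   m + (m - c) = 2m - c arguments; c = 0 gives the integrand of squared_mean. *)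
Definition overlap m (Psi : m.-tuple T -> R) (c : nat)
    (z : (m + (m - c))%N.-tuple T) : R :=
  Psi (subtuple (@lshift m (m - c)%N) z) *
  Psi (subtuple (fun i => cast_ord (addnC (m - c)%N m) (rshift (m - c)%N i)) z).

(* mass at c of the hypergeometric law H(n, m, m) *)
Definition hypergeom (n m c : nat) : R :=
  ('C(m, c) * 'C(n - m, m - c))%N%:R / 'C(n, m)%:R.

Definition var_estimator m n (Psi : m.-tuple T -> R) (z : n.-tuple T) : R :=
  \sum_(1 <= c < m.+1) hypergeom n m c * Ustat (overlap Psi (c := c)) z
  - (1 - hypergeom n m 0) * Ustat (overlap Psi (c := 0)) z.

End ustatistics.

Section regular_parameters.
Context d (T : measurableType d) (R : realType).
Variable Pfam : set (probability T R).

(* The expectation being finite, the measurable function Psi0 is integrable. *)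
Definition regular_with (Theta : probability T R -> R) (k : nat) : Prop :=
  exists Psi0 : k.-tuple T -> R,
    [/\ measurable_fun setT Psi0,
        forall (s : 'S_k) z, Psi0 (subtuple s z) = Psi0 z &
        forall P, Pfam P -> ('E_(iid_law P k)[Psi0] = (Theta P)%:E)%E].

(* Kernels have at least one argument, so a constant parameter has degree 1. *)
Definition has_degree (Theta : probability T R -> R) (k : nat) : Prop :=
  [/\ (0 < k)%N, regular_with Theta k &
      forall j, (0 < j)%N -> regular_with Theta j -> (k <= j)%N].

Definition kappa m (Psi : m.-tuple T -> R) (c : nat) (P : probability T R) : R :=
  fine 'E_(iid_law P (m + (m - c))%N)[overlap Psi (c := c)]%E.

Definition squared_mean m (Psi : m.-tuple T -> R) (P : probability T R) : R :=
  fine 'E_(iid_law P (m + m)%N)[fun z =>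
    (Psi (subtuple (@lshift m m) z) * Psi (subtuple (@rshift m m) z))%R]%E.

End regular_parameters.

Section loss_difference.
Context (R : realType) (X Y : Type) (L : Y * Y -> R) (g : nat).
Variables f f' : g.-tuple (X * Y) * X -> Y.

Definition Phi (z : g.-tuple (X * Y)) (t : X * Y) : R :=
  L (f (z, t.1), t.2) - L (f' (z, t.1), t.2).

(* Phi(z_1,...,z_(i-1),z_(i+1),...,z_(g+1); z_i) *)
Definition Phi_test (i : 'I_g.+1) (z : g.+1.-tuple (X * Y)) : R :=
  Phi (subtuple (lift i) z) (tnth z i).

Definition Phi0 (z : g.+1.-tuple (X * Y)) : R :=
  (g.+1%:R)^-1 * \sum_(i < g.+1) Phi_test i z.

End loss_difference.

(* Main.v *)
Require Import Defs.
From HB Require Import structures.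
From mathcomp Require Import all_boot all_order all_algebra all_fingroup.
From mathcomp Require Import all_classical all_reals all_analysis.
From mathcomp Require Import measurable_realfun ring lra zify.

Set Implicit Arguments.
Unset Strict Implicit.
Unset Printing Implicit Defensive.

Import Order.TTheory GRing.Theory Num.Theory.
Import numFieldNormedType.Exports.

Local Open Scope classical_set_scope.
Local Open Scope ring_scope.

(** Unbiasedness: the mean of a product of kernels over two m-subsets of the
    sample depends only on the size c of their intersection, and c is
    hypergeometric, so the variance of Delta_hat is
    sum_c alpha_c kappa_c - Delta^2.

    Optimality: testing unbiasedness on the uniform laws on finite families of
    points determines the symmetrization of an unbiased estimator pointwise, by
    Moebius inversion over the subfamilies.  As v_hat is symmetric, it is the
    symmetrization of every unbiased estimator, and symmetrizing does not
    increase the variance (Jensen).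

    Consistency: n alpha_c and n (1 - alpha_0) are bounded by m^2, the mean of
    H(n, m, m) being m^2 / n, so it suffices that U-statistics with a bounded
    kernel obey the strong law.  Their variance is O(1 / n), hence they converge
    almost surely along the squares, and boundedness controls the oscillation
    between consecutive squares. *)

(** * Essentially bounded functions and laws of i.i.d. samples *)

(** Equality of symmetrizations holds at every sample rather than almost everywhere, since each
    finite configuration of points carries an admissible law. This is how atomic laws decide the
    comparison under every member of the family. A competing estimator is merely measurable and its
    variance may be infinite, so the variance comparison uses integrals of nonnegative functions.
    Essential boundedness, which depends on the law, is kept for the kernels: it makes their
    expectations real and gives linearity. Laws of samples are compared by one device: a finite
    measure on tuples is determined by its values on boxes. Selecting coordinates, concatenating
    tuples and observing independent variables all become instances of [has_iid_law]. In the strong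
    law the sums are divided by [n ^ k], not by the number of injections: the count of index maps
    that are new between two sample sizes is then a difference of powers, and the two normalizations
    eventually stay within a factor [2 ^ k]. *)

Section ess_bounded.
Context d (T : measurableType d) (R : realType).
Implicit Types (P : probability T R) (f g : T -> R).

Definition ess_bounded P f : Prop :=
  measurable_fun setT f /\ exists B : R, {ae P, forall x, `|f x| <= B}.

Lemma ess_bounded_cst P (r : R) : ess_bounded P (fun=> r).
Proof. by split; [exact: measurable_cst|exists `|r|; apply: aeW]. Qed.

Lemma ess_boundedD P f g : ess_bounded P f -> ess_bounded P g ->
  ess_bounded P (fun x => f x + g x).
Proof.
move=> [mf [B fB]] [mg [C gC]]; split; first exact: measurable_funD.
exists (B + C); apply: filterS2 fB gC => x /= xB xC.
exact: le_trans (ler_normD _ _) (lerD xB xC).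
Qed.

Lemma ess_boundedM P f g : ess_bounded P f -> ess_bounded P g ->
  ess_bounded P (fun x => f x * g x).
Proof.
move=> [mf [B fB]] [mg [C gC]]; split; first exact: measurable_funM.
exists (B * C); apply: filterS2 fB gC => x /= xB xC.
by rewrite normrM ler_pM.
Qed.

Lemma ess_boundedZ P (r : R) f : ess_bounded P f ->
  ess_bounded P (fun x => r * f x).
Proof. exact/ess_boundedM/ess_bounded_cst. Qed.

Lemma ess_boundedB P f g : ess_bounded P f -> ess_bounded P g ->
  ess_bounded P (fun x => f x - g x).
Proof.
move=> bf bg; under eq_fun do rewrite -mulN1r.
exact/ess_boundedD/ess_boundedZ.
Qed.

Lemma ess_bounded_sum P (I : Type) (s : seq I) (p : pred I) (F : I -> T -> R) :
  (forall i, p i -> ess_bounded P (F i)) ->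
  ess_bounded P (fun x => \sum_(i <- s | p i) F i x).
Proof.
move=> bF; elim: s => [|i s IH].
  by under eq_fun do rewrite big_nil; exact: ess_bounded_cst.
under eq_fun do rewrite big_cons.
by case: (p i) (bF i) => // /(_ isT) bi; exact: ess_boundedD.
Qed.

Lemma ess_bounded_integrable P f : ess_bounded P f ->
  P.-integrable setT (EFin \o f).
Proof.
move=> [mf [B fB]]; apply/integrableP; split; first exact/measurable_EFinP.
apply: (@le_lt_trans _ _ (`|B|%:E * P setT)%E).
  apply: integral_le_bound => //; first exact/measurable_EFinP.
  apply: filterS fB => x /= xB _.
  by rewrite lee_fin (le_trans xB)// ler_norm.
by rewrite probability_setT mule1 ltry.
Qed.

Lemma ess_bounded_expectation P f : ess_bounded P f ->
  ('E_P[f] = (\int[P]_x f x)%:E)%E.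
Proof.
move=> bf; rewrite unlock /Rintegral fineK//.
exact: (integrable_fin_num measurableT (ess_bounded_integrable bf)).
Qed.

Lemma ess_bounded_variance P f : ess_bounded P f ->
  ('V_P[f] = (\int[P]_x (f x * f x) - (\int[P]_x f x) ^+ 2)%:E)%E.
Proof.
move=> bf; rewrite /variance unlock.
set m := \int[P]_x f x.
have bm := ess_bounded_cst P m.
rewrite [LHS]ess_bounded_expectation; last first.
  by apply: ess_boundedM; apply: ess_boundedB => //; exact: ess_bounded_cst.
rewrite -[LHS]/((\int[P]_x ((f x - fine 'E_P[f]) * (f x - fine 'E_P[f])))%:E)%E.
rewrite ess_bounded_expectation//= -/m.
congr EFin.
under eq_Rintegral => x _.
  rewrite (_ : _ * _ = f x * f x - 2 * m * f x + m ^+ 2); last first.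
    rewrite -expr2 sqrrB expr2.
    by rewrite -mulr_natl mulrA mulrAC -mulrA.
  over.
rewrite RintegralD// ?RintegralB// ?RintegralZl ?Rintegral_cst//=.
- rewrite probability_setT mulr1 -/m -mulrA -expr2 mulr_natl mulr2n.
  by rewrite opprD addrA subrK.
all: apply: ess_bounded_integrable.
- exact: bm.
- exact: bf.
- exact: ess_boundedM.
- exact: ess_boundedZ.
- by apply: ess_boundedB; [exact: ess_boundedM|exact: ess_boundedZ].
- exact: ess_bounded_cst.
Qed.

Lemma Rintegral_sum P (I : Type) (s : seq I) (p : pred I) (F : I -> T -> R) :
  (forall i, p i -> ess_bounded P (F i)) ->
  \int[P]_x (\sum_(i <- s | p i) F i x) = \sum_(i <- s | p i) \int[P]_x F i x.
Proof.
move=> bF; elim: s => [|i s IH].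
  rewrite big_nil; under eq_Rintegral do rewrite big_nil.
  by rewrite Rintegral_cst// mul0r.
rewrite big_cons; under eq_Rintegral do rewrite big_cons.
case: ifPn => // pi; rewrite RintegralD ?IH//; apply: ess_bounded_integrable.
  exact: bF.
exact: ess_bounded_sum.
Qed.

Lemma Rintegral_norm_le P f (B : R) : measurable_fun setT f ->
  {ae P, forall x, `|f x| <= B} -> `|\int[P]_x f x| <= B.
Proof.
move=> mf fB; have bf : ess_bounded P f by split; [|exists B].
rewrite -lee_fin EFin_normr_Rintegral//; last exact: ess_bounded_integrable.
apply: le_trans (le_abse_integral _ _ _) _ => //; first exact/measurable_EFinP.
have -> : B%:E = (B%:E * P setT)%E by rewrite probability_setT mule1.
have [B0|B0] := leP 0 B.
  apply: integral_le_bound => //; first exact/measurable_EFinP.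
  by apply: filterS fB => x /= xB _; rewrite lee_fin.
(* A negative bound holds nowhere, so the exceptional null set would be everything, against total
   mass 1. *)
have [N [mN PN0 sN]] := fB.
have : P setT = 0%E.
  rewrite -PN0; congr (P _); apply/seteqP; split => // x _.
  by apply: sN => /= /(le_trans (normr_ge0 _)); rewrite leNgt B0.
by rewrite probability_setT => /eqP; rewrite onee_eq0.
Qed.

End ess_bounded.

(** * Boxes determine measures on tuples *)

Section box_uniqueness.
Context d (T : measurableType d) (R : realType).

Definition box n (A : 'I_n -> set T) : set (n.-tuple T) :=
  [set z | forall i, A i (tnth z i)].

Lemma measurable_box n (A : 'I_n -> set T) :
  (forall i, measurable (A i)) -> measurable (box A).
Proof.
move=> mA.
have -> : box A = \bigcap_i ((fun z : n.-tuple T => tnth z i) @^-1` A i).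
  by apply/seteqP; split=> z Hz i //=; apply: Hz.
apply: fin_bigcap_measurable => // i _.
by rewrite -[X in measurable X]setTI; exact: measurable_tnth.
Qed.

(** Boxes are stable under intersection and generate the product sigma-algebra, a coordinate
    preimage being a box with all other sides full, so the uniqueness theorem for measures agreeing
    on a pi-system applies. *)
Lemma box_measure_unique n (m1 m2 : {measure set (n.-tuple T) -> \bar R}) :
  (m1 setT < +oo)%E ->
  (forall A, (forall i, measurable (A i)) -> m1 (box A) = m2 (box A)) ->
  forall E, measurable E -> m1 E = m2 E.
Proof.
move=> m1fin m12 E mE.
pose G := [set box A | A in [set A : 'I_n -> set T | forall i, measurable (A i)]].
have boxT : G setT.
  by exists (fun=> setT) => //=; apply/seteqP; split => // z _ i.
apply: (measure_unique G (fun=> setT)) => //.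
- apply/seteqP; split.
    apply: smallest_sub; first exact: smallest_sigma_algebra.
    move=> B; rewrite -bigcup_seq => -[i /= _ [A mA <-]].
    apply: sub_sigma_algebra.
    exists (fun j => if j == i then A else setT) => /=.
      by move=> j; case: ifP.
    apply/seteqP; split => z /=; first by move=> /(_ i); rewrite eqxx.
    by move=> [_ Az] j; case: ifPn => // /eqP ->.
  apply: smallest_sub; first exact: sigma_algebra_measurable.
  by move=> _ [A mA <-]; exact: measurable_box.
- move=> _ _ [A mA <-] [B mB <-]; exists (fun i => A i `&` B i) => /=.
    by move=> i; exact: measurableI.
  apply/seteqP; split => z /=; first by move=> AB; split => i; have [] := AB i.
  by move=> [zA zB] i; split; [exact: zA|exact: zB].
- by apply/seteqP; split => // z _; exists 0%N.
- by move=> _ [A mA <-]; exact: m12.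
Qed.

End box_uniqueness.

Section has_iid_law.
Context d (T : measurableType d) (R : realType) (P : probability T R).

Definition has_iid_law d' (Omega : measurableType d') (Q : probability Omega R)
    n (X : Omega -> n.-tuple T) : Prop :=
  measurable_fun setT X /\
  forall E, measurable E -> Q (X @^-1` E) = iid_law P n E.

Lemma iid_law_boxE n (A : 'I_n -> set T) : (forall i, measurable (A i)) ->
  iid_law P n (box A) = (\prod_(i < n) P (A i))%E.
Proof. exact: iid_law_box. Qed.

Section transfer.
Context d' (Omega : measurableType d') (Q : probability Omega R).
Context n (X : Omega -> n.-tuple T).

Lemma has_iid_law_box : measurable_fun setT X ->
  (forall A, (forall i, measurable (A i)) ->
     Q (X @^-1` box A) = (\prod_(i < n) P (A i))%E) ->
  has_iid_law Q X.
Proof.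
move=> mX QX; split => // E mE.
pose mX' := isMeasurableFun.Build _ _ _ _ _ mX.
pose X' : {RV Q >-> (n.-tuple T)} := HB.pack X mX'.
rewrite -[LHS]/(distribution Q X' E).
apply: box_measure_unique => //=.
  by rewrite /distribution /pushforward preimage_setT probability_setT ltry.
by move=> A mA; rewrite iid_law_boxE// -QX.
Qed.

Hypothesis hX : has_iid_law Q X.

Lemma has_iid_law_ae (G : n.-tuple T -> Prop) :
  {ae iid_law P n, forall z, G z} -> {ae Q, forall w, G (X w)}.
Proof.
move=> [N [mN N0 sN]]; have [mX QX] := hX; exists (X @^-1` N); split.
- by rewrite -[X in measurable X]setTI; exact: mX.
- by rewrite QX.
- by move=> w /= Gw; apply: sN.
Qed.

Lemma has_iid_law_ess_bounded f :
  ess_bounded (iid_law P n) f -> ess_bounded Q (f \o X).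
Proof.
move=> [mf [B fB]]; have [mX _] := hX; split; first exact: measurableT_comp.
by exists B; exact: (has_iid_law_ae fB).
Qed.

Lemma has_iid_law_Rintegral f : ess_bounded (iid_law P n) f ->
  \int[Q]_w f (X w) = \int[iid_law P n]_z f z.
Proof.
move=> bf; have [mX QX] := hX; congr fine.
rewrite -[LHS]/(\int[Q]_(w in X @^-1` setT) (((EFin \o f) \o X) w))%E.
rewrite -integral_pushforward//.
- apply: eq_measure_integral => E mE _.
  exact: QX.
- by apply/measurable_EFinP; case: bf.
- apply: (ess_bounded_integrable (has_iid_law_ess_bounded bf)).
Qed.

Lemma has_iid_law_ge0_integral (f : n.-tuple T -> R) : measurable_fun setT f ->
  (forall z, 0 <= f z) ->
  (\int[Q]_w (f (X w))%:E = \int[iid_law P n]_z (f z)%:E)%E.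
Proof.
move=> mf f0; have [mX QX] := hX.
rewrite -[LHS]/(\int[Q]_(w in X @^-1` setT) (((EFin \o f) \o X) w))%E.
rewrite -ge0_integral_pushforward//.
- by apply: eq_measure_integral => E mE _; exact: QX.
- exact/measurable_EFinP.
- by move=> z _; rewrite lee_fin.
Qed.

End transfer.

Lemma measurable_subtuple k n (s : 'I_k -> 'I_n) :
  measurable_fun setT (@subtuple T k n s).
Proof.
apply/measurable_fun_tnthP => i.
rewrite (_ : _ \o _ = fun z => tnth z (s i)); first exact: measurable_tnth.
by apply/funext => z /=; rewrite tnth_mktuple.
Qed.

(** The preimage of a box is a box: side [s i] is [A i], by injectivity without conflict, and the
    sides outside the range of [s] are full, hence contribute the factor 1. *)
Lemma has_iid_law_subtuple k n (s : 'I_k -> 'I_n) : injective s ->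
  has_iid_law (iid_law P n) (subtuple s).
Proof.
move=> inj_s; apply: has_iid_law_box; first exact: measurable_subtuple.
move=> A mA.
pose B (j : 'I_n) := if [pick i | s i == j] is Some i then A i else setT.
have Bs i : B (s i) = A i.
  rewrite /B; case: pickP => [i' /eqP /inj_s -> //|/(_ i)]; by rewrite eqxx.
have -> : subtuple s @^-1` box A = box B.
  apply/seteqP; split => z /= Hz.
    move=> j; rewrite /B; case: pickP => // i /eqP <-.
    by have := Hz i; rewrite tnth_mktuple.
  by move=> i; rewrite tnth_mktuple -Bs; exact: Hz.
rewrite iid_law_boxE; last by move=> j; rewrite /B; case: pickP.
rewrite (bigID (fun j => j \in codom s))/= [X in (_ * X)%E]big1 ?mule1; last first.
  move=> j; rewrite /B; case: pickP => [i /eqP <-|_ _]; first by rewrite codom_f.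
  by rewrite probability_setT.
have -> : (\prod_(i < k) P (A i) = \prod_(i < k) P (B (s i)))%E.
  by apply: eq_bigr => i _; rewrite Bs.
rewrite -[RHS](big_map s xpredT (fun j => P (B j)))/=.
rewrite -[LHS]big_filter; apply: perm_big; apply: uniq_perm.
- by rewrite filter_uniq// index_enum_uniq.
- by rewrite map_inj_uniq// index_enum_uniq.
- move=> j; rewrite mem_filter mem_index_enum andbT.
  apply/codomP/mapP => [[i ->]|[i _ ->]]; last by exists i.
  by exists i => //; rewrite mem_index_enum.
Qed.

(** Concatenation carries the product of the two sample laws to the law of a sample of size [k + l],
    as boxes show; Fubini then separates the integral. *)
Lemma iid_law_prod k l f g :
  ess_bounded (iid_law P k) f -> ess_bounded (iid_law P l) g ->
  \int[iid_law P (k + l)]_z (f (subtuple (@lshift k l) z) *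
                            g (subtuple (@rshift k l) z)) =
  \int[iid_law P k]_x f x * \int[iid_law P l]_y g y.
Proof.
move=> bf bg.
pose X (p : k.-tuple T * l.-tuple T) : (k + l).-tuple T :=
  [tuple of p.1 ++ p.2].
have X1 p : subtuple (@lshift k l) (X p) = p.1.
  by apply: eq_from_tnth => i; rewrite tnth_mktuple tnth_lshift.
have X2 p : subtuple (@rshift k l) (X p) = p.2.
  by apply: eq_from_tnth => i; rewrite tnth_mktuple tnth_rshift.
pose Q : probability _ R := (iid_law P k \x iid_law P l)%E.
have hX : has_iid_law Q X.
  apply: has_iid_law_box.
    apply/measurable_fun_tnthP => i; case: (split_ordP i) => j ->.
      rewrite (_ : _ \o _ = (fun z => tnth z j) \o fst).
        by apply: measurableT_comp => //; exact: measurable_tnth.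
      by apply/funext => p /=; rewrite tnth_lshift.
    rewrite (_ : _ \o _ = (fun z => tnth z j) \o snd).
      by apply: measurableT_comp => //; exact: measurable_tnth.
    by apply/funext => p /=; rewrite tnth_rshift.
  move=> A mA.
  have -> : X @^-1` box A = box (fun i => A (lshift l i)) `*`
                           box (fun i => A (rshift k i)).
    apply/seteqP; split => -[x y] /=.
      move=> Hz; split => i.
        by have := Hz (lshift l i); rewrite tnth_lshift.
      by have := Hz (rshift k i); rewrite tnth_rshift.
    move=> [Hx Hy] i; case: (split_ordP i) => j ->.
      by rewrite tnth_lshift.
    by rewrite tnth_rshift.
  rewrite -[LHS]/((iid_law P k \x iid_law P l)%E _) product_measure1E//.
  - by rewrite big_split_ord/=; congr (_ * _)%E; exact: iid_law_box.
  - exact: measurable_box.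
  - exact: measurable_box.
have bfl : ess_bounded (iid_law P (k + l)) (f \o subtuple (@lshift k l)).
  exact/has_iid_law_ess_bounded/bf/has_iid_law_subtuple/lshift_inj.
have bgr : ess_bounded (iid_law P (k + l)) (g \o subtuple (@rshift k l)).
  exact/has_iid_law_ess_bounded/bg/has_iid_law_subtuple/rshift_inj.
have bfg := ess_boundedM bfl bgr.
rewrite -(has_iid_law_Rintegral hX bfg)/=.
have /ess_bounded_integrable iQ := has_iid_law_ess_bounded hX bfg.
have fin_f := integrable_fin_num measurableT (ess_bounded_integrable bf).
have fin_g := integrable_fin_num measurableT (ess_bounded_integrable bg).
rewrite /Rintegral -fineM//; congr fine.
rewrite -[LHS]integral12_prod_meas1//=.
transitivity (\int[iid_law P k]_x
    ((f x)%:E * \int[iid_law P l]_y (EFin \o g) y))%E.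
  apply: eq_integral => x _.
  rewrite /fubini_F -integralZl//; last exact: ess_bounded_integrable.
  by apply: eq_integral => y _ /=; rewrite X1 X2 EFinM.
rewrite -(fineK fin_g)/= integralZr//; exact: ess_bounded_integrable.
Qed.

End has_iid_law.

(** * Symmetric kernels and unbiasedness *)

Section symmetric_kernel.
Context (T : Type) (R : realType).

Definition symmetric_kernel k (Psi : k.-tuple T -> R) : Prop :=
  forall (s : 'S_k) z, Psi (subtuple s z) = Psi z.

Lemma subtuple_comp j k n (s : 'I_k -> 'I_n) (t : 'I_j -> 'I_k) (z : n.-tuple T) :
  subtuple t (subtuple s z) = subtuple (s \o t) z.
Proof. by apply: eq_from_tnth => i; rewrite !tnth_mktuple. Qed.

Lemma eq_subtuple k n (s t : 'I_k -> 'I_n) (z : n.-tuple T) :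
  s =1 t -> subtuple s z = subtuple t z.
Proof. by move=> st; apply: eq_from_tnth => i; rewrite !tnth_mktuple st. Qed.

Lemma injective_imset_perm k n (s t : 'I_k -> 'I_n) :
  injective s -> injective t -> [set s i | i : 'I_k] = [set t i | i : 'I_k] ->
  exists p : 'S_k, s =1 t \o p.
Proof.
move=> inj_s inj_t st.
have sE i : exists j, s i == t j.
  have : s i \in [set t i | i : 'I_k] by rewrite -st imset_f.
  by case/imsetP => j _ ->; exists j.
pose p i := xchoose (sE i).
have pE i : s i = t (p i) by exact/eqP/(xchooseP (sE i)).
have inj_p : injective p by move=> i j pij; apply: inj_s; rewrite !pE pij.
by exists (perm inj_p) => i /=; rewrite permE pE.
Qed.

Lemma symmetric_kernel_subtuple k n (Psi : k.-tuple T -> R)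
    (s t : 'I_k -> 'I_n) (z : n.-tuple T) :
  symmetric_kernel Psi -> injective s -> injective t ->
  [set s i | i : 'I_k] = [set t i | i : 'I_k] ->
  Psi (subtuple s z) = Psi (subtuple t z).
Proof.
move=> symPsi inj_s inj_t /(injective_imset_perm inj_s inj_t)[p sE].
by rewrite (eq_subtuple _ sE) -subtuple_comp symPsi.
Qed.

Lemma subsample_inj k n (S : {S : {set 'I_n} | #|S| == k}) :
  injective (fun i : 'I_k => enum_val (cast_ord (esym (eqP (valP S))) i)).
Proof. by move=> i j /enum_val_inj /cast_ord_inj. Qed.

Lemma subsampleE k n (Psi : k.-tuple T -> R) (S : {S : {set 'I_n} | #|S| == k})
    (t : 'I_k -> 'I_n) (z : n.-tuple T) :
  symmetric_kernel Psi -> injective t -> [set t i | i : 'I_k] = val S ->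
  Psi (subsample S z) = Psi (subtuple t z).
Proof.
move=> symPsi inj_t tS; apply: symmetric_kernel_subtuple => //.
  exact: subsample_inj.
rewrite tS; apply/eqP; rewrite eqEcard; apply/andP; split.
  by apply/fintype.subsetP => _ /imsetP[i _ ->]; exact: enum_valP.
rewrite card_imset; last exact: subsample_inj.
by rewrite card_ord (eqP (valP S)).
Qed.

End symmetric_kernel.

(** * Counting subsets by the size of their overlap *)

Lemma card_injections k n :
  #|[pred s : {ffun 'I_k -> 'I_n} | injectiveb s]| = (n ^_ k)%N.
Proof.
rewrite -[in RHS](card_ord n) -[in RHS](card_ord k) -card_inj_ffuns.
by apply: eq_card => s; rewrite [RHS]inE.
Qed.

(** [t] lists [A :\: B], then [A :&: B], then [B :\: A]: the first [m] positions fill [A] and the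
    last [m] fill [B], which is the pattern of arguments in [overlap]. *)
Lemma overlapping_injection n m (A B : {set 'I_n}) :
  #|A| = m -> #|B| = m ->
  let c := #|A :&: B| in
  exists t : 'I_(m + (m - c)) -> 'I_n,
    [/\ injective t, [set t (lshift (m - c)%N i) | i : 'I_m] = A &
        [set t (cast_ord (addnC (m - c)%N m) (rshift (m - c)%N i)) | i : 'I_m] = B].
Proof.
move=> Am Bm c.
have cAB : #|A :\: B| = (m - c)%N by rewrite cardsD Am.
have cBA : #|B :\: A| = (m - c)%N by rewrite cardsD Bm finset.setIC.
have cm : (c <= m)%N by rewrite -Am subset_leq_card// finset.subsetIl.
pose e := enum (A :\: B) ++ enum (A :&: B) ++ enum (B :\: A).
have se : size e == (m + (m - c))%N.
  by rewrite !size_cat -!cardE cAB cBA addnA subnK.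
pose t := tnth (Tuple se).
have tE i x0 : t i = nth x0 e i by rewrite /t (tnth_nth x0).
have inj_t : injective t.
  apply/tuple_uniqP => /=; rewrite !cat_uniq !enum_uniq /= andbT.
  apply/andP; split; apply/hasPn => x; rewrite ?mem_cat !mem_enum !inE.
    by case: (x \in A); case: (x \in B).
  by case: (x \in A); case: (x \in B).
exists t; split => //; apply/eqP; rewrite eqEcard.
  apply/andP; split; last first.
    by rewrite card_imset ?card_ord ?Am// => i j /inj_t /lshift_inj.
  apply/fintype.subsetP => _ /imsetP[i _ ->]; rewrite (tE _ (t (lshift _ i))) /e catA.
  have lti : (i < size (enum (A :\: B) ++ enum (A :&: B)))%N.
    by rewrite size_cat -!cardE cAB subnK.
  rewrite nth_cat lti; have := mem_nth (t (lshift _ i)) lti.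
  by rewrite mem_cat !mem_enum !inE => /orP[/andP[]|/andP[]].
apply/andP; split; last first.
  by rewrite card_imset ?card_ord ?Bm// => i j /inj_t /cast_ord_inj /rshift_inj.
apply/fintype.subsetP => _ /imsetP[i _ ->].
set x := t _; rewrite /x (tE _ x) /e nth_cat /= -cardE cAB ltnNge leq_addr/=.
rewrite addKn.
have lti : (i < size (enum (A :&: B) ++ enum (B :\: A)))%N.
  by rewrite size_cat -!cardE cBA -/c subnKC.
have := mem_nth x lti.
by rewrite mem_cat !mem_enum !inE => /orP[/andP[]|/andP[]].
Qed.

(** Such a set splits uniquely into [c] elements of [A] and [m - c] elements of its complement; [DP]
    recovers the two pieces from their union. *)
Lemma card_draws_overlap n m c (A : {set 'I_n}) : (c <= m)%N ->
  #|[set B : {set 'I_n} | (#|B| == m) && (#|A :&: B| == c)]%SET| =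
  ('C(#|A|, c) * 'C(n - #|A|, m - c))%N.
Proof.
move=> cm.
have -> : ('C(n - #|A|, m - c) = 'C(#|~: A|, m - c))%N.
  by rewrite (cardsCs (~: A)) finset.setCK card_ord.
rewrite -!cards_draws -cardsX.
set D := finset.setX _ _.
have DP (p : {set 'I_n} * {set 'I_n}) : p \in D ->
    (A :&: (p.1 :|: p.2) = p.1) * ((p.1 :|: p.2) :\: A = p.2).
  rewrite !inE => /andP[/andP[p1A _] /andP[p2A _]]; split.
    apply/setP => x; move: (fintype.subsetP p1A x) (fintype.subsetP p2A x).
    by rewrite !inE; do 3 case: (x \in _); move=> //= h1 h2;
      first [by have := h1 isT | by have := h2 isT].
  apply/setP => x; move: (fintype.subsetP p1A x) (fintype.subsetP p2A x).
  by rewrite !inE; do 3 case: (x \in _); move=> //= h1 h2;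
      first [by have := h1 isT | by have := h2 isT].
have injD : {in D &, injective (fun p : {set 'I_n} * {set 'I_n} => p.1 :|: p.2)}.
  move=> p q /DP[p1 p2] /DP[q1 q2] pq.
  rewrite [p]surjective_pairing [q]surjective_pairing.
  by congr (_, _); [rewrite -p1 pq q1|rewrite -p2 pq q2].
rewrite -(card_in_imset injD); apply: eq_card => B.
apply/idP/imsetP => [|[p pD ->]].
  rewrite inE => /andP[/eqP Bm /eqP ABc].
  exists (A :&: B, B :\: A) => /=; last first.
    by apply/setP => x; rewrite !inE; case: (x \in A); case: (x \in B).
  rewrite !inE/= finset.subsetIl ABc eqxx/= finset.subsetDr/= cardsD finset.setIC ABc Bm eqxx.
  by [].
have [pE1 pE2] := DP _ pD; rewrite inE.
rewrite pE1; move: pD; rewrite !inE => /andP[/andP[_ /eqP c1] /andP[p2A /eqP c2]].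
rewrite c1 eqxx andbT.
rewrite -(cardsID A) finset.setIC pE1 pE2 c1 c2 subnKC//.
Qed.

Lemma sum_overlap (V : nmodType) n m (A : {set 'I_n}) (F : nat -> V) :
  #|A| = m ->
  \sum_(B : {B : {set 'I_n} | #|B| == m}) F #|A :&: val B| =
  \sum_(c < m.+1) F c *+ ('C(m, c) * 'C(n - m, m - c))%N.
Proof.
move=> Am.
transitivity (\sum_(B : {set 'I_n} | #|B| == m) F #|A :&: B|).
  by rewrite [RHS]big_sub.
have cle (B : {set 'I_n}) : (#|A :&: B| < m.+1)%N.
  by rewrite ltnS -Am subset_leq_card// finset.subsetIl.
rewrite (partition_big (fun B : {set 'I_n} => Ordinal (cle B)) xpredT)//=.
apply: eq_bigr => c _.
rewrite (eq_bigr (fun=> F c)); last by move=> B /andP[_ /eqP <-].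
have := @card_draws_overlap n m c A; rewrite Am => <-; last by rewrite -ltnS.
rewrite sumr_const; congr (_ *+ _); apply: eq_card => B; rewrite [RHS]inE.
by rewrite unfold_in -val_eqE.
Qed.

(** * Moments of U-statistics and unbiasedness of the estimator *)

Section unbiasedness.
Context d (T : measurableType d) (R : realType) (P : probability T R).

Lemma ess_bounded_subtuple k n (s : 'I_k -> 'I_n) (f : k.-tuple T -> R) :
  injective s -> ess_bounded (iid_law P k) f ->
  ess_bounded (iid_law P n) (fun z => f (subtuple s z)).
Proof.
by move=> inj_s; apply: has_iid_law_ess_bounded; exact: has_iid_law_subtuple.
Qed.

Lemma Rintegral_subtuple k n (s : 'I_k -> 'I_n) (f : k.-tuple T -> R) :
  injective s -> ess_bounded (iid_law P k) f ->
  \int[iid_law P n]_z f (subtuple s z) = \int[iid_law P k]_z f z.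
Proof.
by move=> inj_s; apply: has_iid_law_Rintegral; exact: has_iid_law_subtuple.
Qed.

Lemma ess_bounded_Ustat m n (Psi : m.-tuple T -> R) :
  ess_bounded (iid_law P m) Psi ->
  ess_bounded (iid_law P n) (@Ustat R T m n Psi).
Proof.
move=> bPsi; apply: ess_boundedZ; apply: ess_bounded_sum => s /injectiveP inj_s.
exact: ess_bounded_subtuple.
Qed.

Lemma Rintegral_Ustat m n (Psi : m.-tuple T -> R) :
  ess_bounded (iid_law P m) Psi -> (m <= n)%N ->
  \int[iid_law P n]_z Ustat Psi z = \int[iid_law P m]_z Psi z.
Proof.
move=> bPsi mn; have bs (s : {ffun 'I_m -> 'I_n}) : injectiveb s ->
    ess_bounded (iid_law P n) (fun z => Psi (subtuple s z)).
  by move=> /injectiveP inj_s; exact: ess_bounded_subtuple.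
rewrite RintegralZl//; last exact/ess_bounded_integrable/ess_bounded_sum.
rewrite Rintegral_sum// (eq_bigr (fun=> \int[iid_law P m]_z Psi z)); last first.
  by move=> s /injectiveP inj_s; exact: Rintegral_subtuple.
rewrite sumr_const -[X in _ * X]mulr_natl mulrA mulVf ?mul1r//.
by rewrite card_injections pnatr_eq0 -lt0n ffact_gt0.
Qed.

Lemma shift_inj m l :
  injective (fun i : 'I_m => cast_ord (addnC l m) (rshift l i)).
Proof. by move=> i j /cast_ord_inj /rshift_inj. Qed.

Section kernel.
Context m (Psi : m.-tuple T -> R).
Hypothesis bPsi : ess_bounded (iid_law P m) Psi.

Lemma ess_bounded_overlap c :
  ess_bounded (iid_law P (m + (m - c))) (overlap Psi (c := c)).
Proof.
apply: ess_boundedM; apply: ess_bounded_subtuple => //.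
  exact: lshift_inj.
exact: shift_inj.
Qed.

Lemma Rintegral_overlap0 :
  \int[iid_law P (m + (m - 0))]_z overlap Psi (c := 0) z =
  (\int[iid_law P m]_z Psi z) ^+ 2.
Proof.
(* [m - 0] sits in a tuple type, so it is generalized before being replaced by [m]; the two blocks
   of arguments are then visibly disjoint. *)
rewrite /overlap; move: (m - 0)%N (subn0 m) => l lm; subst l.
rewrite expr2 -iid_law_prod//; apply: eq_Rintegral => z _.
congr (_ * Psi _); apply: eq_subtuple => i; exact: val_inj.
Qed.

Hypothesis symPsi : symmetric_kernel Psi.

Lemma ess_bounded_subsample n (S : {S : {set 'I_n} | #|S| == m}) :
  ess_bounded (iid_law P n) (fun z => Psi (subsample S z)).
Proof. exact/ess_bounded_subtuple/bPsi/subsample_inj. Qed.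

Lemma ess_bounded_Ustat_sym n :
  ess_bounded (iid_law P n) (@Ustat_sym R T m n Psi).
Proof.
by apply: ess_boundedZ; apply: ess_bounded_sum => S _; exact: ess_bounded_subsample.
Qed.

(** Both subsamples are read through the single injection listing the union of [A] and [B]; symmetry
    makes the order inside each subsample irrelevant, and selection along an injection keeps the
    law. *)
Lemma Rintegral_subsampleM n (A B : {S : {set 'I_n} | #|S| == m}) :
  let c := #|val A :&: val B| in
  \int[iid_law P n]_z (Psi (subsample A z) * Psi (subsample B z)) =
  \int[iid_law P (m + (m - c))]_z overlap Psi (c := c) z.
Proof.
move=> c.
have [t [inj_t tA tB]] := overlapping_injection (eqP (valP A)) (eqP (valP B)).
rewrite -(Rintegral_subtuple inj_t); last exact: ess_bounded_overlap.
apply: eq_Rintegral => z _; rewrite /overlap !subtuple_comp; congr (_ * _).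
  apply: subsampleE => //; apply: inj_comp => //; exact: lshift_inj.
apply: subsampleE => //; apply: inj_comp => //; exact: shift_inj.
Qed.

Lemma variance_Ustat_sym n : (m <= n)%N ->
  ('V_(iid_law P n)[@Ustat_sym R T m n Psi] =
   (\sum_(c < m.+1) hypergeom R n m c *
      (\int[iid_law P (m + (m - c))]_z overlap Psi (c := c) z) -
    (\int[iid_law P m]_z Psi z) ^+ 2)%:E)%E.
Proof.
move=> mn; rewrite ess_bounded_variance; last exact: ess_bounded_Ustat_sym.
have C0 : 'C(n, m)%:R != 0 :> R by rewrite pnatr_eq0 -lt0n bin_gt0.
have cardD : #|{: {S : {set 'I_n} | #|S| == m}}| = 'C(n, m).
  rewrite card_sig -[in RHS](card_ord n) -cardsT -cards_draws.
  by apply: eq_card => S; rewrite !inE finset.subsetT.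
congr (_ - _ ^+ 2)%:E.
  under eq_Rintegral => z _.
    rewrite (_ : _ * _ = ('C(n, m)%:R)^-1 ^+ 2 *
      \sum_(A : {S : {set 'I_n} | #|S| == m})
        \sum_(B : {S : {set 'I_n} | #|S| == m})
          Psi (subsample A z) * Psi (subsample B z)); last first.
      by rewrite /Ustat_sym mulrACA -expr2 big_distrlr.
    over.
  have bAB (A B : {S : {set 'I_n} | #|S| == m}) : ess_bounded (iid_law P n)
      (fun z => Psi (subsample A z) * Psi (subsample B z)).
    by apply: ess_boundedM; exact: ess_bounded_subsample.
  rewrite RintegralZl//; last first.
    apply: ess_bounded_integrable; apply: ess_bounded_sum => A _.
    exact: ess_bounded_sum.
  rewrite Rintegral_sum; last by move=> A _; exact: ess_bounded_sum.
  (* By [sum_overlap] the inner sum does not depend on [A], so the outer one only multiplies by the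
     number of subsets, which cancels one of the two normalizing factors. *)
  rewrite (eq_bigr (fun=> \sum_(c < m.+1)
      (\int[iid_law P (m + (m - c))]_z overlap Psi (c := c) z) *+
        ('C(m, c) * 'C(n - m, m - c))%N)).
    rewrite sumr_const cardD -[X in _ * X]mulr_natl mulrA expr2 divfK//.
    rewrite mulr_sumr.
    apply: eq_bigr => c _; rewrite /hypergeom -[X in _ * X = _]mulr_natl mulrA; congr (_ * _).
    by rewrite mulrC.
  move=> A _; rewrite Rintegral_sum//.
  rewrite -(sum_overlap
    (fun c => \int[iid_law P (m + (m - c))]_z overlap Psi (c := c) z)
    (eqP (valP A))).
  by apply: eq_bigr => B _; exact: Rintegral_subsampleM.
rewrite RintegralZl//; last first.
  by apply: ess_bounded_integrable; apply: ess_bounded_sum => S _;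
    exact: ess_bounded_subsample.
rewrite Rintegral_sum; last by move=> S _; exact: ess_bounded_subsample.
rewrite (eq_bigr (fun=> \int[iid_law P m]_z Psi z)); last first.
  by move=> S _; apply: Rintegral_subtuple => //; exact: subsample_inj.
by rewrite sumr_const cardD -[X in _ * X]mulr_natl mulrA mulVf// mul1r.
Qed.

Lemma ess_bounded_var_estimator n :
  ess_bounded (iid_law P n) (@var_estimator R T m n Psi).
Proof.
apply: ess_boundedB.
  apply: ess_bounded_sum => c _; apply: ess_boundedZ.
  exact/ess_bounded_Ustat/ess_bounded_overlap.
exact/ess_boundedZ/ess_bounded_Ustat/ess_bounded_overlap.
Qed.

Lemma Rintegral_var_estimator n : (m + m <= n)%N ->
  \int[iid_law P n]_z var_estimator Psi z =
  \sum_(1 <= c < m.+1) hypergeom R n m c *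
    (\int[iid_law P (m + (m - c))]_z overlap Psi (c := c) z) -
  (1 - hypergeom R n m 0) *
    (\int[iid_law P (m + (m - 0))]_z overlap Psi (c := 0) z).
Proof.
move=> mn; have bU c : ess_bounded (iid_law P n)
    (@Ustat R T _ n (overlap Psi (c := c))).
  exact/ess_bounded_Ustat/ess_bounded_overlap.
have EU c : \int[iid_law P n]_z Ustat (overlap Psi (c := c)) z =
    \int[iid_law P (m + (m - c))]_z overlap Psi (c := c) z.
  (* The average over injections must be nonempty even for [c = 0], whose kernel has [m + m]
     arguments. *)
  apply: Rintegral_Ustat; first exact: ess_bounded_overlap.
  by rewrite (leq_trans _ mn)// leq_add2l leq_subr.
rewrite RintegralB//; last 2 first.
- apply/ess_bounded_integrable/ess_bounded_sum => c _; exact/ess_boundedZ/bU.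
- exact/ess_bounded_integrable/ess_boundedZ/bU.
rewrite Rintegral_sum; last by move=> c _; exact/ess_boundedZ/bU.
rewrite RintegralZl//; last exact/ess_bounded_integrable/bU.
rewrite EU; congr (_ - _); apply: eq_bigr => c _.
rewrite RintegralZl ?EU//; exact/ess_bounded_integrable/bU.
Qed.

(** The variance formula has a term for [c = 0], namely [hypergeom n m 0] times the squared mean;
    merged with the subtracted squared mean it produces the factor [1 - hypergeom n m 0]. *)
Lemma var_estimator_unbiased n : (m + m <= n)%N ->
  ('E_(iid_law P n)[@var_estimator R T m n Psi] =
   'V_(iid_law P n)[@Ustat_sym R T m n Psi])%E.
Proof.
move=> mn; rewrite variance_Ustat_sym; last by rewrite (leq_trans _ mn)// leq_addr.
rewrite ess_bounded_expectation; last exact: ess_bounded_var_estimator.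
rewrite Rintegral_var_estimator// Rintegral_overlap0.
rewrite -(big_mkord xpredT (fun c => hypergeom R n m c *
  \int[iid_law P (m + (m - c))]_z overlap Psi (c := c) z)) [in RHS]big_ltn//.
rewrite Rintegral_overlap0; congr EFin.
by rewrite mulrBl mul1r opprB addrA; congr (_ - _); rewrite addrC.
Qed.

End kernel.

End unbiasedness.

(** * Minimum variance *)

Section empirical.
Context d (T : measurableType d) (R : realType).

(** A normalized sum of Dirac masses; a list rather than a set is used so that coinciding sample
    points keep their multiplicity. *)
Lemma empirical_probability (s : seq T) : (0 < size s)%N ->
  exists P : probability T R,
    (forall A, measurable A ->
       P A = ((size s)%:R^-1 * \sum_(x <- s) \1_A x)%:E) /\
    (forall f : T -> R, measurable_fun setT f ->
       ('E_P[f] = ((size s)%:R^-1 * \sum_(x <- s) f x)%:E)%E).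
Proof.
move=> s0.
have r0 : 0 <= (size s)%:R^-1 :> R by rewrite invr_ge0.
pose delta i : {measure set T -> \bar R} := \d_(nth point s i).
pose mu : {measure set T -> \bar R} := mscale (NngNum r0) (msum delta (size s)).
have muE A : mu A = ((size s)%:R^-1 * \sum_(x <- s) \1_A x)%:E.
  rewrite /mu /mscale/= /msum EFinM; congr (_ * _)%E.
  by rewrite (big_nth point) big_mkord -sumEFin; apply: eq_bigr.
have mu1 : mu setT = 1%E.
  rewrite muE (eq_bigr (fun=> 1)); last by move=> x _; rewrite indicT.
  by rewrite big_const_seq count_predT iter_addr_0 mulVf// pnatr_eq0 -lt0n.
pose P : probability T R :=
  HB.pack (Measure.sort mu) (Measure_isProbability.Build _ _ _ mu mu1).
have int_ge0 (f : T -> R) : measurable_fun setT f -> (forall x, 0 <= f x) ->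
    (\int[mu]_x (f x)%:E = ((size s)%:R^-1 * \sum_(x <- s) f x)%:E)%E.
  move=> mf f0; have mf' : measurable_fun setT (EFin \o f).
    exact/measurable_EFinP.
  rewrite ge0_integral_mscale//=; last by move=> x _; rewrite lee_fin.
  rewrite ge0_integral_measure_sum//; last by move=> x _; rewrite lee_fin.
  rewrite EFinM; congr (_ * _)%E.
  rewrite (big_nth point) big_mkord -sumEFin; apply: eq_bigr => i _.
  by rewrite integral_dirac// diracT mul1e.
exists P; split=> [A mA|f mf]; first exact: muE.
rewrite unlock -[LHS]/(\int[mu]_x (f x)%:E)%E integralE.
rewrite (eq_integral (fun x => (f^\+ x)%:E)); last first.
  by move=> x _; rewrite funeposE /funrpos/= EFin_max.
rewrite [X in (_ - X)%E](eq_integral (fun x => (f^\- x)%:E)); last first.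
  by move=> x _; rewrite funenegE /funrneg/= EFin_max.
rewrite !int_ge0//; last 2 first.
- exact: measurable_funrneg.
- exact: measurable_funrpos.
rewrite -EFinB -mulrBr -sumrB; congr (_ * _)%:E; apply: eq_bigr => x _.
by rewrite -[in RHS](funrposBneg f).
Qed.

End empirical.

(** Moebius inversion as an induction on the size of [A]: removing the maps with smaller image
    leaves those with image exactly [A], and the maps onto all of ['I_n] are the injective ones. *)
Lemma sum_injective_eq0 (V : zmodType) n (F : {ffun 'I_n -> 'I_n} -> V) :
  (forall A : {set 'I_n}, \sum_(s in ffun_on (mem A)) F s = 0) ->
  \sum_(s : {ffun 'I_n -> 'I_n} | injectiveb s) F s = 0.
Proof.
move=> F0.
pose im (s : {ffun 'I_n -> 'I_n}) := [set s i | i : 'I_n]%SET.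
have imE A : \sum_(s | im s == A) F s = 0.
  have [k] := ubnP #|A|; elim: k A => // k IH A; rewrite ltnS => Ak.
  have := F0 A; rewrite (partition_big im (fun B => B \subset A))/=; last first.
    move=> s /ffun_onP sA; apply/fintype.subsetP => _ /imsetP[i _ ->].
    exact: sA.
  rewrite (bigD1 A)//= [X in _ + X]big1 ?addr0 => [sF|B /andP[BA BnA]].
    rewrite -[RHS]sF; apply: eq_bigl => s; apply/idP/andP => [/eqP sA|[]//]; split; last exact/eqP.
    by apply/ffun_onP => i; rewrite -sA; apply: imset_f.
  rewrite -[RHS](IH B); last first.
    by rewrite (leq_trans _ Ak)// proper_card// finset.properEneq BnA.
  apply: eq_bigl => s; apply/andP/idP => [[]//|/eqP sB]; split; last exact/eqP.
  apply/ffun_onP => i; apply: (fintype.subsetP BA); rewrite -sB.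
  exact: imset_f.
rewrite -[RHS](imE finset.setT); apply: eq_bigl => s; apply/injectiveP/eqP => [inj_s|sT].
  by apply/eqP; rewrite eqEcard finset.subsetT cardsT (card_imset _ inj_s) leqnn.
have /imset_injP inj_s : #|im s| == #|'I_n| by rewrite sT cardsT.
by move=> i j; apply: inj_s.
Qed.

(** * Test laws, symmetrization and Jensen's inequality *)

Section optimality.
Context d (T : measurableType d) (R : realType).

(* Writing m_A for the uniform law on the points z_i, i in A, the expectation
   under m_A^n is the average over the maps into A, and Moebius inversion over
   A extracts the sum over the bijections. *)
Lemma unbiased_eq_sum_injective n (Pfam : set (probability T R))
    (T1 T2 : n.-tuple T -> R) :
  (0 < n)%N -> (forall x : T, measurable [set x]) ->
  (forall P : probability T R, purely_discontinuous P -> Pfam P) ->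
  measurable_fun setT T1 -> measurable_fun setT T2 ->
  (forall P, Pfam P -> 'E_(iid_law P n)[T1] = 'E_(iid_law P n)[T2])%E ->
  forall z : n.-tuple T,
    \sum_(s : {ffun 'I_n -> 'I_n} | injectiveb s) T1 (subtuple s z) =
    \sum_(s : {ffun 'I_n -> 'I_n} | injectiveb s) T2 (subtuple s z).
Proof.
move=> n0 m1 Pfamd mT1 mT2 E12 z; apply/eqP; rewrite -subr_eq0 -sumrB; apply/eqP.
apply: (sum_injective_eq0 (F := fun s => T1 (subtuple s z) - T2 (subtuple s z))).
move=> A; have [A0|A0] := posnP #|A|.
  (* The empty set carries no law, but as [n] is positive there is no map into it either. *)
  rewrite big_pred0// => s; apply/negbTE/negP => /ffun_onP /(_ (Ordinal n0)).
  by rewrite (cards0_eq A0) inE.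
pose sA := [seq tnth z i | i <- enum A].
pose sF := [seq subtuple s z |
  s : {ffun 'I_n -> 'I_n} <- enum (ffun_on (mem A))].
have szA : size sA = #|A| by rewrite size_map -cardE.
have szF : size sF = (#|A| ^ n)%N.
  by rewrite size_map -cardE card_ffun_on card_ord.
have sA0 : (0 < size sA)%N by rewrite szA.
have [P [PE _]] := empirical_probability R sA0.
have sF0 : (0 < size sF)%N by rewrite szF expn_gt0 A0.
have [Q [QE QI]] := empirical_probability R sF0.
(* On a box the product of [n] averages over [A] expands by distributivity into one average over all
   maps into [A], so the product of uniform laws is the uniform law on the list [sF]. *)
have PQ B : measurable B -> iid_law P n B = Q B.
  apply: box_measure_unique; first exact: (le_lt_trans (probability_le1 _ measurableT) (ltry _)).
  move=> C mC; apply: etrans (esym (QE _ (measurable_box mC))).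
  transitivity (\prod_(i < n) P (C i))%E; first exact: iid_law_box.
  under eq_bigr do rewrite PE//.
  rewrite prodEFin; congr EFin.
  rewrite big_split/= prodr_const card_ord szA szF natrX exprVn; congr (_ * _).
  rewrite big_map big_enum/= -/(ffun_on _).
  under eq_bigr do rewrite big_map big_enum/=.
  rewrite bigA_distr_big/=; apply: eq_bigr => s _.
  rewrite indicE.
  have -> : (subtuple s z \in box C) = [forall i, tnth z (s i) \in C i].
    apply/idP/forallP => [/set_mem zC i|zC].
      by apply/mem_set; have := zC i; rewrite tnth_mktuple.
    by apply/mem_set => i; rewrite tnth_mktuple; exact/set_mem/zC.
  case: forallP => [zC|/forallP]; first by rewrite big1// => i _; rewrite indicE zC.
  rewrite negb_forall => /existsP[i iC]; rewrite (bigD1 i)//= indicE (negbTE iC).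
  by rewrite mul0r.
have EPQ f : ('E_(iid_law P n)[f] = 'E_Q[f])%E.
  by rewrite unlock; apply: eq_measure_integral => B mB _; exact: PQ.
have msA : measurable [set` sA].
  rewrite (_ : [set` sA] = \big[setU/set0]_(x <- sA) [set x]).
    by apply: bigsetU_measurable.
  by rewrite -bigcup_seq; apply/seteqP; split => x /=;
    [move=> xs; exists x|case=> y ys ->].
have dP : Pfam P.
  apply: Pfamd; exists [set` sA]; split => //.
  - exact: finite_set_countable.
  - rewrite PE; last exact: measurableC.
    rewrite big1_seq ?mulr0// => x /andP[_ xs].
    by rewrite indicE memNset// => nxs; exact: nxs.
have := E12 P dP; rewrite !EPQ !QI// => -[]/eqP.
rewrite (inj_eq (mulfI _)) ?invr_eq0 ?pnatr_eq0 -?lt0n// => /eqP.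
rewrite !big_map !big_enum/= => T12.
by rewrite sumrB T12 subrr.
Qed.

Lemma Ustat_subtuple k n (Psi : k.-tuple T -> R) (p : 'I_n -> 'I_n) z :
  injective p -> Ustat Psi (subtuple p z) = Ustat Psi z.
Proof.
move=> inj_p; congr (_ * _).
pose h (s : {ffun 'I_k -> 'I_n}) := [ffun i => p (s i)] : {ffun 'I_k -> 'I_n}.
have [q pK qK] := injF_bij inj_p.
pose h' (s : {ffun 'I_k -> 'I_n}) := [ffun i => q (s i)] : {ffun 'I_k -> 'I_n}.
have hK : cancel h h' by move=> s; apply/ffunP => i; rewrite !ffunE pK.
have hK' : cancel h' h by move=> s; apply/ffunP => i; rewrite !ffunE qK.
rewrite [RHS](reindex h)/=; last by exists h' => s _.
apply: eq_big => s.
  apply/injectiveP/injectiveP => [inj_s i j|inj_s i j sij].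
    by rewrite !ffunE => /inj_p /inj_s.
  by apply: inj_s; rewrite !ffunE sij.
move=> _; rewrite subtuple_comp; congr Psi; apply: eq_subtuple => i /=.
by rewrite ffunE.
Qed.

(** With as many arguments as observations, [Ustat] is symmetrization over all permutations; a
    symmetric statistic can thus be written as its own symmetrization. *)
Lemma Ustat_id n (f : n.-tuple T -> R) z :
  (forall p : 'I_n -> 'I_n, injective p -> f (subtuple p z) = f z) ->
  Ustat f z = f z.
Proof.
move=> sym; rewrite /Ustat (eq_bigr (fun=> f z)); last first.
  by move=> s /injectiveP /sym.
rewrite sumr_const -[X in _ * X]mulr_natl mulrA mulVf ?mul1r//.
by rewrite card_injections pnatr_eq0 -lt0n ffact_gt0.
Qed.

(** Jensen's inequality for the square: the squared deviations from the mean have a nonnegative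
    sum. *)
Lemma sqr_mean_le (I : finType) (p : pred I) (a : I -> R) :
  (0 < #|p|)%N ->
  ((#|p|%:R)^-1 * \sum_(i | p i) a i) ^+ 2 <=
  (#|p|%:R)^-1 * \sum_(i | p i) a i ^+ 2.
Proof.
move=> p0; set N : R := #|p|%:R; set mn := N^-1 * _.
have N0 : 0 < N by rewrite ltr0n.
have aE : \sum_(i | p i) a i = N * mn by rewrite mulrA divff ?gt_eqF// mul1r.
have : 0 <= \sum_(i | p i) (a i - mn) ^+ 2.
  by apply: sumr_ge0 => i _; exact: sqr_ge0.
under eq_bigr do rewrite sqrrB -mulrnAr.
rewrite big_split/= sumrB -mulr_suml aE sumr_const.
rewrite -[X in _ + X]mulr_natl -/N => H.
rewrite ler_pdivlMl// -subr_ge0; move: H; congr (_ <= _).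
rewrite mulrnAr -mulrA -expr2 mulr2n opprD addrA subrK.
by [].
Qed.

(** Equal means give both variances the same centre [mn]. Jensen's inequality is applied at each
    sample, and every permuted copy of the squared deviation has the same, possibly infinite,
    integral. *)
Lemma variance_Ustat_le (P : probability T R) n (f : n.-tuple T -> R) :
  measurable_fun setT f ->
  'E_(iid_law P n)[@Ustat R T n n f]%E = 'E_(iid_law P n)[f]%E ->
  ('V_(iid_law P n)[@Ustat R T n n f] <= 'V_(iid_law P n)[f])%E.
Proof.
move=> mf Ef; rewrite /variance unlock Ef; set mn := fine _.
rewrite unlock/=.
pose p := [pred s : {ffun 'I_n -> 'I_n} | injectiveb s].
have p0 : (0 < #|p|)%N by rewrite card_injections ffact_gt0.
pose G (z : n.-tuple T) := (f z - mn) ^+ 2.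
have mG : measurable_fun setT G.
  by apply: measurable_funX; apply: measurable_funB => //; exact: measurable_cst.
have G0 z : 0 <= G z by exact: sqr_ge0.
have mGs (s : {ffun 'I_n -> 'I_n}) : measurable_fun setT (fun z => G (subtuple s z)).
  exact: (measurableT_comp mG (measurable_subtuple s)).
apply: (@le_trans _ _ (\int[iid_law P n]_z
   ((#|p|%:R)^-1 * \sum_(s | p s) G (subtuple s z))%:E)%E).
  apply: ge0_le_integral => //.
  - by move=> z _; rewrite lee_fin -expr2 sqr_ge0.
  - apply/measurable_EFinP.
    suff mU : measurable_fun setT (fun z => @Ustat R T n n f z - mn).
      exact: measurable_funM.
    apply: measurable_funB; last exact: measurable_cst.
    apply: measurable_funM; first exact: measurable_cst.
    under eq_fun do rewrite -big_filter.
    apply: measurable_sum => s.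
    exact: measurableT_comp (measurable_subtuple s).
  - apply/measurable_EFinP; apply: measurable_funM; first exact: measurable_cst.
    by under eq_fun do rewrite -big_filter; apply: measurable_sum => s.
  - move=> z _; rewrite lee_fin.
    have H : ((#|p|%:R)^-1 * \sum_(s | p s) (f (subtuple s z) - mn)) ^+ 2 <=
        (#|p|%:R)^-1 * \sum_(s | p s) G (subtuple s z) :=
      sqr_mean_le (fun s : {ffun 'I_n -> 'I_n} => f (subtuple s z) - mn) p0.
    apply: le_trans H.
    have -> : \sum_(s | p s) (f (subtuple s z) - mn) =
        \sum_(s | p s) f (subtuple s z) - #|p|%:R * mn.
      by rewrite sumrB sumr_const mulr_natl.
    have -> : (#|p|%:R)^-1 * (\sum_(s | p s) f (subtuple s z) - #|p|%:R * mn) =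
        @Ustat R T n n f z - mn.
      by rewrite mulrBr mulKf// pnatr_eq0 -lt0n.
    by rewrite expr2.
under eq_integral do rewrite EFinM -sumEFin -big_filter.
rewrite ge0_integralZl//; last 2 first.
- by apply: emeasurable_sum => s; exact/measurable_EFinP.
- by move=> z _; apply: sume_ge0 => s _; rewrite lee_fin.
rewrite ge0_integral_sum//; last 2 first.
- by move=> s; exact/measurable_EFinP.
- by move=> s z _; rewrite lee_fin.
rewrite big_filter (eq_bigr (fun=> \int[iid_law P n]_z (G z)%:E)%E); last first.
  move=> s /injectiveP inj_s.
  exact: (has_iid_law_ge0_integral (has_iid_law_subtuple P inj_s) mG G0).
(* The repeated term may be [+oo]; its nonnegativity justifies turning the iterated sum into a
   multiple. *)
have iterE k (x : \bar R) : (0 <= x -> iter k (adde x) 0 = k%:R%:E * x)%E.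
  move=> x0; elim: k => [|k IH]; first by rewrite mul0e.
  by rewrite iterS IH -nat1r EFinD ge0_muleDl ?mul1e// lee_fin.
rewrite big_const iterE; last by apply: integral_ge0 => z _; rewrite lee_fin.
rewrite muleA -EFinM mulVf ?mul1e; last by rewrite pnatr_eq0 -lt0n.
by under eq_integral do rewrite /G expr2.
Qed.

End optimality.

(** * Strong law of large numbers for U-statistics *)

(** Fixing one value leaves [n ^ (k - 1)] maps; multiplying by [n] avoids the subtraction in the
    exponent. *)
Lemma card_ffun_eval k n (j : 'I_k) (a : 'I_n) :
  (#|[pred t : {ffun 'I_k -> 'I_n} | t j == a]| * n = n ^ k)%N.
Proof.
pose F (i : 'I_k) : pred 'I_n := if i == j then pred1 a else predT.
have -> : #|[pred t : {ffun 'I_k -> 'I_n} | t j == a]| = #|family F|.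
  apply: eq_card => t; rewrite !inE; apply/eqP/familyP => [ta i|/(_ j)].
    by rewrite /F; case: eqP => [->|_]; rewrite inE ?ta.
  by rewrite /F eqxx inE => /eqP.
rewrite card_family foldrE big_map big_enum/= (bigD1 j)//=.
rewrite {1}/F eqxx card1 mul1n (eq_bigr (fun=> n)); last first.
  by move=> i ij; rewrite /F (negbTE ij) card_ord.
by rewrite prod_nat_const cardC1 card_ord -expnSr prednK// (leq_ltn_trans _ (ltn_ord j)).
Qed.

Section second_moment.
Context d (T : measurableType d) (R : realType) (P : probability T R).

Lemma Rintegral_disjoint k n (s t : 'I_k -> 'I_n) (f g : k.-tuple T -> R) :
  injective s -> injective t -> (forall i j, s i != t j) ->
  ess_bounded (iid_law P k) f -> ess_bounded (iid_law P k) g ->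
  \int[iid_law P n]_z (f (subtuple s z) * g (subtuple t z)) =
  \int[iid_law P k]_z f z * \int[iid_law P k]_z g z.
Proof.
move=> inj_s inj_t st bf bg.
pose u (i : 'I_(k + k)) := match fintype.split i with inl j => s j | inr j => t j end.
have ul i : u (lshift k i) = s i by rewrite /u (unsplitK (inl i)).
have ur i : u (rshift k i) = t i by rewrite /u (unsplitK (inr i)).
have inj_u : injective u.
  move=> i j; case: (split_ordP i) => {}i ->; case: (split_ordP j) => {}j ->;
    rewrite ?ul ?ur.
  - by move/inj_s ->.
  - by move/eqP; rewrite (negbTE (st _ _)).
  - by move/esym/eqP; rewrite (negbTE (st _ _)).
  - by move/inj_t ->.
rewrite -iid_law_prod// -(Rintegral_subtuple inj_u); last first.
  apply: ess_boundedM; apply: ess_bounded_subtuple => //.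
    exact: lshift_inj.
  exact: rshift_inj.
apply: eq_Rintegral => z _; rewrite !subtuple_comp; congr (f _ * g _).
  by apply: eq_subtuple => i /=; rewrite ul.
by apply: eq_subtuple => i /=; rewrite ur.
Qed.

(** When the square is expanded, index maps with disjoint ranges contribute 0 by independence and
    centring, the others at most [B ^+ 2]. For each of the [k ^ 2] pairs of positions, a proportion
    [1 / n] of all pairs of maps agree there. *)
Lemma second_moment_le k n (h : k.-tuple T -> R) (B : R) :
  (0 < n)%N -> measurable_fun setT h ->
  {ae iid_law P k, forall z, `|h z| <= B} ->
  \int[iid_law P k]_z h z = 0 ->
  \int[iid_law P n]_z
    ((\sum_(s : {ffun 'I_k -> 'I_n} | injectiveb s) h (subtuple s z)) /
     n%:R ^+ k) ^+ 2 <= (k%:R ^+ 2 * B ^+ 2) / n%:R.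
Proof.
move=> n0 mh hB h0; have bh : ess_bounded (iid_law P k) h by split; [|exists B].
have n0' : 0 < n%:R :> R by rewrite ltr0n.
have bhs (s : {ffun 'I_k -> 'I_n}) : injectiveb s ->
    ess_bounded (iid_law P n) (fun z => h (subtuple s z)).
  by move=> /injectiveP inj_s; exact: ess_bounded_subtuple.
have bst (s t : {ffun 'I_k -> 'I_n}) : injectiveb s -> injectiveb t ->
    ess_bounded (iid_law P n) (fun z => h (subtuple s z) * h (subtuple t z)).
  by move=> ? ?; apply: ess_boundedM; exact: bhs.
under eq_Rintegral => z _.
  rewrite expr_div_n -exprM expr2 big_distrlr/= mulrC; over.
rewrite RintegralZl//; last first.
  apply/ess_bounded_integrable/ess_bounded_sum => s ?.
  by apply: ess_bounded_sum => t ?; exact: bst.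
rewrite Rintegral_sum; last first.
  by move=> s ?; apply: ess_bounded_sum => t ?; exact: bst.
rewrite ler_pdivrMl ?exprn_gt0//.
(* Coincidences are counted with multiplicity: this still dominates the covariance and, as a sum
   over pairs of positions, is easy to total over all maps, injective or not. *)
pose hit (s t : {ffun 'I_k -> 'I_n}) : R :=
  \sum_(i < k) \sum_(j < k) B ^+ 2 * (s i == t j)%:R.
have hit_ge0 s t : 0 <= hit s t.
  by apply: sumr_ge0 => i _; apply: sumr_ge0 => j _; rewrite mulr_ge0 ?sqr_ge0.
have cov_le (s t : {ffun 'I_k -> 'I_n}) : injectiveb s -> injectiveb t ->
    \int[iid_law P n]_z (h (subtuple s z) * h (subtuple t z)) <= hit s t.
  move=> Is It; have [/injectiveP inj_s /injectiveP inj_t] := (Is, It).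
  have [/existsP[i /existsP[j sij]]|disj] :=
      boolP [exists i, exists j, s i == t j].
    apply: (@le_trans _ _ (B ^+ 2)).
      apply: le_trans (ler_norm _) _; apply: Rintegral_norm_le.
        by have [] := bst _ _ Is It.
      have hBs := has_iid_law_ae (has_iid_law_subtuple P inj_s) hB.
      have hBt := has_iid_law_ae (has_iid_law_subtuple P inj_t) hB.
      by apply: filterS2 hBs hBt => z zs zt; rewrite normrM expr2 ler_pM.
    rewrite /hit (bigD1 i)//= (bigD1 j)//= sij mulr1 -addrA lerDl addr_ge0//.
      by apply: sumr_ge0 => j' _; rewrite mulr_ge0 ?sqr_ge0.
    apply: sumr_ge0 => i' _; apply: sumr_ge0 => j' _.
    by rewrite mulr_ge0 ?sqr_ge0.
  rewrite Rintegral_disjoint// ?h0 ?mul0r// => i j.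
  by move: disj; rewrite negb_exists => /forallP/(_ i);
    rewrite negb_exists => /forallP/(_ j).
apply: (@le_trans _ _ (\sum_s \sum_t hit s t)).
  rewrite [leRHS](bigID (fun s : {ffun 'I_k -> 'I_n} => injectiveb s))/=.
  rewrite -[leLHS]addr0 lerD//; last first.
    by apply: sumr_ge0 => s _; apply: sumr_ge0.
  apply: ler_sum => s Is.
  rewrite Rintegral_sum; last by move=> t ?; exact: bst.
  rewrite [leRHS](bigID (fun s : {ffun 'I_k -> 'I_n} => injectiveb s))/=.
  rewrite -[leLHS]addr0 lerD//; last exact: sumr_ge0.
  by apply: ler_sum => t It; exact: cov_le.
pose c : R := n%:R ^+ k / n%:R.
have cE (j : 'I_k) (a : 'I_n) :
    \sum_(t : {ffun 'I_k -> 'I_n}) (a == t j)%:R = c.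
  rewrite (eq_bigr (fun t : {ffun 'I_k -> 'I_n} => if a == t j then 1 else 0));
    last by move=> t _; case: eqP.
  rewrite -big_mkcond sumr_const /c -natrX -(card_ffun_eval j a) natrM.
  rewrite mulfK ?gt_eqF//; congr (_%:R); apply: eq_card => t.
  by rewrite !inE eq_sym.
rewrite (eq_bigr (fun=> \sum_(i < k) \sum_(j < k) B ^+ 2 * c)); last first.
  move=> s _; rewrite exchange_big/=; apply: eq_bigr => i _.
  rewrite exchange_big/=; apply: eq_bigr => j _.
  by rewrite -mulr_sumr cE.
rewrite !sumr_const card_ffun !card_ord -[leLHS]mulr_natl natrX.
rewrite -[X in _ * X <= _]mulr_natl -[X in _ * (_ * X) <= _]mulr_natl.
rewrite exprM /c.
have -> : n%:R ^+ k * (k%:R * (k%:R * (B ^+ 2 * (n%:R ^+ k / n%:R)))) =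
  (n%:R ^+ k) ^+ 2 * (k%:R ^+ 2 * B ^+ 2 / n%:R) :> R.
  by field; rewrite gt_eqF.
by [].
Qed.

End second_moment.

(** * Almost sure convergence along the squares and between them *)

Section ae_cvg.
Context (R : realType).

(** Telescoping through [1 / (n + 1) ^ 2 <= 1 / n - 1 / (n + 1)]. *)
Lemma sum_inv_sqr_le n : \sum_(0 <= j < n) (j.+1%:R ^+ 2)^-1 <= 2 - n%:R^-1 :> R.
Proof.
elim: n => [|n IH]; first by rewrite big_nil invr0 subr0.
(* Since [0^-1] is [0], the telescoping step does not cover the passage to [n = 1]. *)
case: n IH => [_|n IH]; first by rewrite big_nat1 expr1n invr1; lra.
rewrite big_nat_recr//=; apply: le_trans (lerD IH (lexx _)) _.
set x : R := n.+1%:R; have x0 : 0 < x by rewrite ltr0n.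
rewrite -(natr1 n.+1) -/x -subr_ge0.
have x1 : 0 < x + 1 by rewrite addr_gt0.
have -> : 2 - (x + 1)^-1 - (2 - x^-1 + ((x + 1) ^+ 2)^-1) =
    x^-1 / (x + 1) ^+ 2 by field; rewrite !gt_eqF.
by rewrite divr_ge0 ?invr_ge0 ?sqr_ge0 ?ltW.
Qed.

(** The expected sum of the squares is at most [C * 2], so the series of squares converges almost
    surely and its terms tend to 0. *)
Lemma ae_cvg0_of_second_moment d (Omega : measurableType d)
    (Q : probability Omega R) (X : nat -> Omega -> R) (C : R) :
  (forall j, ess_bounded Q (X j)) ->
  (forall j, \int[Q]_w (X j w) ^+ 2 <= C / j.+1%:R ^+ 2) ->
  {ae Q, forall w, X ^~ w @ \oo --> (0 : R)}.
Proof.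
move=> bX XC.
have C0 : 0 <= C.
  have := XC 0%N; rewrite expr1n divr1; apply: le_trans.
  by apply: Rintegral_ge0 => w _; exact: sqr_ge0.
have mX2 j : measurable_fun setT (fun w => ((X j w) ^+ 2)%:E).
  by apply/measurable_EFinP; apply: measurable_funX; have [] := bX j.
have X20 j w : (0 <= ((X j w) ^+ 2)%:E)%E by rewrite lee_fin sqr_ge0.
have int_fin j : (\int[Q]_w ((X j w) ^+ 2)%:E = (\int[Q]_w (X j w) ^+ 2)%:E)%E.
  rewrite /Rintegral fineK//; apply: integrable_fin_num => //.
  apply: (ess_bounded_integrable (f := fun w => X j w ^+ 2)).
  by under eq_fun do rewrite expr2; exact: ess_boundedM.
have sum_le : (\int[Q]_w (\sum_(j <oo) ((X j w) ^+ 2)%:E) <= (C * 2)%:E)%E.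
  rewrite integral_nneseries//; apply: lime_le.
    by apply: is_cvg_nneseries => j _ _; exact: integral_ge0.
  apply: nearW => n.
  under eq_bigr do rewrite int_fin.
  rewrite sumEFin lee_fin; apply: le_trans (ler_sum _ (fun j _ => XC j)) _.
  rewrite -mulr_sumr ler_wpM2l//; apply: le_trans (sum_inv_sqr_le n) _.
  by rewrite lerBlDr lerDl invr_ge0.
have intS : Q.-integrable setT (fun w => \sum_(j <oo) ((X j w) ^+ 2)%:E)%E.
  apply/integrableP; split.
    by apply: ge0_emeasurable_sum => // j w _ _; exact: X20.
  apply: le_lt_trans (ltry (C * 2)); apply: le_trans sum_le.
  rewrite le_eqVlt; apply/orP; left; apply/eqP; apply: eq_integral => w _.
  by rewrite gee0_abs//; apply: nneseries_ge0 => j _ _; exact: X20.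
have := integrable_ae measurableT intS; apply: filterS => w /(_ I) fin_w.
have cvgS : cvgn (series (fun j => (X j w) ^+ 2)).
  apply: nondecreasing_is_cvgn.
    apply: nondecreasing_series => j _ _; exact: sqr_ge0.
  exists (fine (\sum_(j <oo) ((X j w) ^+ 2)%:E)%E) => _ [n _ <-].
  rewrite -lee_fin fineK// /series/= -sumEFin.
  by apply: nneseries_lim_ge => j _ _; exact: X20.
have /cvgrPdist_lt sq0 := cvg_series_cvg_0 cvgS.
apply/cvgrPdist_lt => e e0; have := sq0 _ (exprn_gt0 2 e0).
apply: filterS => j; rewrite !sub0r !normrN.
by rewrite normrX ltr_pXn2r// ?nnegrE// ltW.
Qed.

Lemma sqr_bracket J n : (J.+1 ^ 2 <= n)%N ->
  exists2 j, (J <= j)%N & (j.+1 ^ 2 <= n < j.+2 ^ 2)%N.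
Proof.
move=> Jn.
have exP : exists j, (j.+1 ^ 2 <= n)%N by exists J.
have bP j : (j.+1 ^ 2 <= n)%N -> (j <= n)%N.
  by apply: leq_trans; rewrite -mulnn; nia.
case: (ex_maxnP exP bP) => j jn jmax; exists j; first exact: jmax.
by rewrite jn/= ltnNge; apply/negP => /jmax; rewrite ltnn.
Qed.

Lemma sqr_gap j n : (n < j.+2 ^ 2)%N -> (n <= 3 * j.+1 + j.+1 ^ 2)%N.
Proof. by rewrite -!mulnn; nia. Qed.

(** Bernoulli's inequality, applied later to the ratio of a square to a nearby sample size. *)
Lemma one_sub_exp_le (x : R) k : 0 <= x <= 1 -> 1 - x ^+ k <= k%:R * (1 - x).
Proof.
move=> /andP[x0 x1]; elim: k => [|k IH]; first by rewrite expr0 subrr mul0r.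
have xk1 : x ^+ k <= 1 by rewrite exprn_ile1.
have xk0 : 0 <= x ^+ k by rewrite exprn_ge0.
rewrite exprS -natr1; nra.
Qed.

(** If [N] is the largest square up to [n], of side [j + 1], then [n - N <= 3 (j + 1)], so the
    increment relative to [n ^ k] is at most [C k (1 - N / n)], which is of order [1 / j]. *)
Lemma cvg0_of_squares k (a : nat -> R) (C : R) : 0 <= C ->
  (forall N n, (0 < N)%N -> (N <= n)%N ->
    `|a n - a N| <= C * (n%:R ^+ k - N%:R ^+ k)) ->
  (fun j => a (j.+1 ^ 2)%N / (j.+1 ^ 2)%N%:R ^+ k) @ \oo --> (0 : R) ->
  (fun n => a n / n%:R ^+ k) @ \oo --> (0 : R).
Proof.
move=> C0 aC /cvgrPdist_le b0; apply/cvgrPdist_le => e e0.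
have e20 : 0 < e / 2 by rewrite divr_gt0.
have [J1 _ bJ] := b0 _ e20.
pose D := C * (k%:R * 3).
have D0 : 0 <= D by rewrite !mulr_ge0.
(* Beyond [J2] the oscillation [D / (j + 1)] is at most half of [e]; beyond [J1] the value at the
   square takes the other half. *)
pose J2 := Num.truncn (D / (e / 2)).
pose J := maxn J1 J2.
exists (J.+1 ^ 2)%N => // n /= /sqr_bracket[j Jj /andP[Nn nN]].
set N := (j.+1 ^ 2)%N in Nn.
have N0 : (0 < N)%N by rewrite expn_gt0.
have n0 : (0 < n)%N by exact: leq_trans Nn.
have nR : 0 < n%:R :> R by rewrite ltr0n.
have NR : 0 < N%:R :> R by rewrite ltr0n.
have j0 : 0 < j.+1%:R :> R by rewrite ltr0n.
have bj : `|a N / N%:R ^+ k| <= e / 2.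
  have := bJ j (leq_trans (leq_maxl _ _) Jj).
  by rewrite /= sub0r normrN.
rewrite sub0r normrN normrM normfV (ger0_norm (exprn_ge0 _ (ltW nR))).
rewrite ler_pdivrMr ?exprn_gt0//.
have aN : `|a N| <= e / 2 * N%:R ^+ k.
  move: bj; rewrite normrM normfV (ger0_norm (exprn_ge0 _ (ltW NR))).
  by rewrite ler_pdivrMr ?exprn_gt0.
have an : `|a n| <= `|a N| + C * (n%:R ^+ k - N%:R ^+ k).
  rewrite -[a n](subrK (a N)) addrC; apply: le_trans (ler_normD _ _) _.
  by rewrite lerD2l aC.
apply: le_trans an _.
have NnR : N%:R <= n%:R :> R by rewrite ler_nat.
have x01 : 0 <= (N%:R / n%:R : R) <= 1.
  by rewrite ler_pdivrMr// mul1r NnR divr_ge0// ltW.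
have := one_sub_exp_le k x01; rewrite expr_div_n => H1.
have H2 : 1 - N%:R / n%:R <= 3 / j.+1%:R :> R.
  have -> : 1 - N%:R / n%:R = (n%:R - N%:R) / n%:R :> R.
    by rewrite mulrBl divff// gt_eqF.
  rewrite ler_pdivrMr//; apply: (@le_trans _ _ (3 / j.+1%:R * N%:R)); last first.
    by rewrite ler_wpM2l// divr_ge0// ltW.
  rewrite /N natrX expr2 mulrA divfK ?gt_eqF// lerBlDr.
  rewrite -expr2 -natrX -natrM -natrD ler_nat; exact: sqr_gap nN.
have H3 : C * (n%:R ^+ k - N%:R ^+ k) <= e / 2 * n%:R ^+ k.
  have -> : n%:R ^+ k - N%:R ^+ k = (1 - N%:R ^+ k / n%:R ^+ k) * n%:R ^+ k :> R.
    by rewrite mulrBl mul1r divfK// expf_neq0// gt_eqF.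
  rewrite mulrA; apply: ler_wpM2r; first by rewrite exprn_ge0// ltW.
  apply: (@le_trans _ _ (C * (k%:R * (3 / j.+1%:R)))).
    by rewrite ler_wpM2l// (le_trans H1)// ler_wpM2l.
  rewrite !mulrA -(mulrA C) -/D ler_pdivrMr// -ler_pdivrMl// mulrC.
  rewrite ltW// -truncn_le_nat; exact: leq_trans (leq_maxr J1 J2) Jj.
have H4 : `|a N| <= e / 2 * n%:R ^+ k.
  apply: le_trans aN _; rewrite ler_wpM2l ?(ltW e20)//.
  by rewrite lerXn2r// nnegrE ltW.
apply: le_trans (lerD H4 H3) _.
by rewrite -mulrDl -splitr.
Qed.

End ae_cvg.

(** * Increments of injective sums and the strong law *)

Section strong_law.
Context d (T : measurableType d) (R : realType).

(** The injections with all values below [N] reproduce the smaller sum; the remaining ones are among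
    the [n ^ k - N ^ k] maps that take some value outside that range. *)
Lemma inj_sum_increment k N n (h : k.-tuple T -> R) (x : nat -> T) (B : R) :
  (0 < N)%N -> (N <= n)%N ->
  (forall n (s : {ffun 'I_k -> 'I_n}), injective s ->
    `|h (subtuple s [tuple x i | i < n])| <= B) ->
  `|\sum_(s : {ffun 'I_k -> 'I_n} | injectiveb s)
      h (subtuple s [tuple x i | i < n]) -
    \sum_(s : {ffun 'I_k -> 'I_N} | injectiveb s)
      h (subtuple s [tuple x i | i < N])| <= `|B| * (n%:R ^+ k - N%:R ^+ k).
Proof.
move=> N0 Nn hB.
pose small (s : {ffun 'I_k -> 'I_n}) := [forall i, (s i < N)%N].
pose emb (s : {ffun 'I_k -> 'I_N}) : {ffun 'I_k -> 'I_n} :=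
  [ffun i => widen_ord Nn (s i)].
(* [res] inverts [emb] on small maps; the default [Ordinal N0] is reached only outside them. *)
pose res (t : {ffun 'I_k -> 'I_n}) : {ffun 'I_k -> 'I_N} :=
  [ffun i => insubd (Ordinal N0) (val (t i))].
rewrite (bigID small)/=.
have -> : \sum_(s : {ffun 'I_k -> 'I_n} | injectiveb s && small s)
      h (subtuple s [tuple x i | i < n]) = \sum_(s : {ffun 'I_k -> 'I_N} | injectiveb s)
      h (subtuple s [tuple x i | i < N]).
  rewrite (reindex_onto emb res); last first.
    move=> t /andP[_ /forallP tN]; apply/ffunP => i; rewrite !ffunE.
    by apply: val_inj; rewrite /= val_insubd tN.
  apply: eq_big => [s|s _]; last first.
    congr h; apply: eq_from_tnth => i; rewrite !tnth_mktuple.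
    by rewrite ffunE.
  have -> : small (emb s) by apply/forallP => i; rewrite ffunE/=.
  have -> : res (emb s) == s.
    apply/eqP/ffunP => i; rewrite !ffunE; apply: val_inj.
    by rewrite val_insubd /= ltn_ord.
  rewrite !andbT; apply/injectiveP/injectiveP => [inj_s i j sij|inj_s i j].
    by apply: inj_s; rewrite !ffunE sij.
  by rewrite !ffunE => /(congr1 val)/= /val_inj; exact: inj_s.
rewrite addrAC subrr add0r; apply: le_trans (ler_norm_sum _ _ _) _.
apply: (@le_trans _ _ (\sum_(s : {ffun 'I_k -> 'I_n} | ~~ small s) `|B|)).
  rewrite [leRHS](bigID (fun s : {ffun 'I_k -> 'I_n} => injectiveb s))/=.
  rewrite -[leLHS]addr0 lerD//; last by apply: sumr_ge0 => s _.
  under eq_bigl do rewrite andbC.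
  apply: ler_sum => s /andP[_ /injectiveP inj_s].
  exact: le_trans (hB _ _ inj_s) (ler_norm _).
rewrite sumr_const -[leLHS]mulr_natr ler_wpM2l//.
have := cardC small; rewrite card_ffun !card_ord => cE.
rewrite -!natrX lerBrDl -natrD ler_nat addnC.
have <- : #|small| = (N ^ k)%N.
  pose F : {pred 'I_n} := [pred i : 'I_n | (i < N)%N].
  have := @card_ffun_on 'I_k 'I_n F; rewrite card_ord => cF.
  transitivity (#|F| ^ k)%N.
    by rewrite -cF; apply: eq_card => s; apply/forallP/ffun_onP => sN i;
      have := sN i; rewrite inE.
  congr (_ ^ _)%N.
  rewrite -sum1_card (eq_bigl (fun i : 'I_n => (i < N)%N))//.
  by rewrite (big_ord_narrow Nn) sum1_card card_ord.
by rewrite -cE addnC leq_add2r; apply: subset_leq_card; exact/fintype.subsetP.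
Qed.

(** Each factor [n - i] of the falling factorial is at least [n / 2]. *)
Lemma expn_le_ffact k n : (k.*2 <= n)%N -> (n ^ k <= 2 ^ k * n ^_ k)%N.
Proof.
elim: k => [//|k IH] kn.
have kn' : (k.*2 <= n)%N by rewrite (leq_trans _ kn)// leq_double.
rewrite ffactnSr !expnSr; apply: leq_trans (leq_mul (IH kn') (leqnn n)) _.
rewrite -!mulnA leq_mul2l [(2 * _)%N]mulnCA leq_mul2l.
by apply/orP; right; apply/orP; right; lia.
Qed.

Context (P : probability T R) d' (Omega : measurableType d').
Context (Q : probability Omega R) (Z : nat -> Omega -> T).
Hypothesis iidZ : iid P Q Z.

Lemma iid_has_iid_law n : has_iid_law P Q (fun w => [tuple Z i w | i < n]).
Proof.
have [mZ ZP indZ] := iidZ; apply: has_iid_law_box.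
  apply/measurable_fun_tnthP => i.
  rewrite (_ : _ \o _ = Z i); first exact: mZ.
  by apply/funext => w /=; rewrite tnth_mktuple.
move=> A mA.
(* Independence is stated for sets indexed by all naturals, so the family is completed by full sets
   from [n] on. *)
pose B i := if insub i is Some j then A j else setT : set T.
have BE (i : 'I_n) : B i = A i.
  by rewrite /B insubT//= => i_n; congr A; exact: val_inj.
have mB i : measurable (B i) by rewrite /B; case: insub.
have -> : (fun w => [tuple Z i w | i < n]) @^-1` box A =
    \bigcap_(i in [set` iota 0 n]) (Z i @^-1` B i).
  apply/seteqP; split => w /= H.
    move=> i /=; rewrite mem_iota/= add0n => i_n.
    have := H (Ordinal i_n); rewrite tnth_mktuple/=.
    by rewrite -[A _]BE.
  move=> i; rewrite tnth_mktuple -BE; apply: H => /=.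
  by rewrite mem_iota/= add0n.
rewrite indZ ?iota_uniq// -[n in iota 0 n]subn0 -/(index_iota 0 n) big_mkord.
by apply: eq_bigr => i _; rewrite ZP// BE.
Qed.

Lemma Ustat_strong_law k (h : k.-tuple T -> R) : (0 < k)%N ->
  ess_bounded (iid_law P k) h ->
  {ae Q, forall w, (fun n => Ustat h [tuple Z i w | i < n]) @ \oo -->
                   (\int[iid_law P k]_z h z : R)}.
Proof.
move=> k0 bh; set theta : R := \int[_]_z _.
pose hc z := h z - theta.
have bhc : ess_bounded (iid_law P k) hc.
  by apply: ess_boundedB => //; exact: ess_bounded_cst.
have hc0 : \int[iid_law P k]_z hc z = 0.
  rewrite RintegralB//; last 2 first.
  - exact: ess_bounded_integrable.
  - exact/ess_bounded_integrable/ess_bounded_cst.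
  by rewrite Rintegral_cst//= probability_setT mulr1 subrr.
have [mhc [B hB]] := bhc.
pose S n (z : n.-tuple T) : R :=
  \sum_(s : {ffun 'I_k -> 'I_n} | injectiveb s) hc (subtuple s z).
have bS n : ess_bounded (iid_law P n) (@S n).
  apply: ess_bounded_sum => s /injectiveP inj_s; exact: ess_bounded_subtuple.
pose X n w := [tuple Z i w | i < n].
(* Sample sizes and index maps are countably many, so one null set serves all the bounds. *)
have ae_bound : {ae Q, forall w, forall n (s : {ffun 'I_k -> 'I_n}),
    injective s -> `|hc (subtuple s (X n w))| <= B}.
  apply: ae_foralln => n; apply: filter_forall => s.
  have [inj_s|ninj_s] := pselect (injective s); last by apply: aeW => w /ninj_s.
  have := has_iid_law_ae (has_iid_law_subtuple P inj_s) hB.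
  by move/(has_iid_law_ae (iid_has_iid_law n)); apply: filterS => w + _.
pose Y j w : R := S _ (X (j.+1 ^ 2)%N w) / (j.+1 ^ 2)%N%:R ^+ k.
have ae_sq : {ae Q, forall w, Y ^~ w @ \oo --> (0 : R)}.
  apply: (@ae_cvg0_of_second_moment R _ _ Q Y (k%:R ^+ 2 * B ^+ 2)) => j.
    rewrite /Y; under eq_fun do rewrite mulrC; apply: ess_boundedZ.
    exact: (has_iid_law_ess_bounded (iid_has_iid_law _) (bS _)).
  have N0 : (0 < j.+1 ^ 2)%N by rewrite expn_gt0.
  have := second_moment_le N0 mhc hB hc0; rewrite [in leRHS]natrX; apply: le_trans.
  rewrite -(has_iid_law_Rintegral (iid_has_iid_law _)); last first.
    under eq_fun do rewrite expr2.
    apply: ess_boundedM; under eq_fun do rewrite mulrC; exact/ess_boundedZ/bS.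
  by rewrite lexx.
apply: filterS2 ae_bound ae_sq => w hBw Yw.
have Sw : (fun n => S n (X n w) / n%:R ^+ k) @ \oo --> (0 : R).
  apply: (@cvg0_of_squares R k (fun n => S n (X n w)) `|B|) => // N n N0 Nn.
  apply: (inj_sum_increment (x := Z ^~ w) N0 Nn) => n' s; exact: hBw.
have UE n : (k <= n)%N -> Ustat h (X n w) - theta = (n ^_ k)%:R^-1 * S n (X n w).
  move=> kn; rewrite /Ustat card_injections /S sumrB sumr_const.
  rewrite (eq_card (B := [pred s : {ffun 'I_k -> 'I_n} | injectiveb s]))//.
  rewrite card_injections mulrBr -[X in _ - _ * X]mulr_natl mulKf//.
  by rewrite pnatr_eq0 -lt0n ffact_gt0.
apply/cvgrPdist_le => e e0.
(* The accuracy [e / 2 ^+ k] pays for replacing [n ^ k] by the falling factorial. *)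
have /cvgrPdist_le/(_ (e / 2 ^+ k)) := Sw.
rewrite divr_gt0 ?exprn_gt0// => /(_ isT) [n1 _ Hn].
exists (maxn n1 k.*2) => // n /= nn.
have n1n : (n1 <= n)%N by rewrite (leq_trans _ nn)// leq_maxl.
have k2n : (k.*2 <= n)%N by rewrite (leq_trans _ nn)// leq_maxr.
have kn : (k <= n)%N by rewrite (leq_trans _ k2n)// -addnn leq_addr.
have n0 : (0 < n)%N by rewrite (leq_trans k0).
have := Hn n n1n; rewrite /= sub0r normrN.
rewrite (distrC theta) -/(X n w) UE// !normrM !normfV !normr_nat normrX normr_nat.
rewrite ler_pdivrMr ?exprn_gt0 ?ltr0n// mulrAC => H.
rewrite ler_pdivrMl ?ltr0n ?ffact_gt0//.
apply: le_trans H _; rewrite ler_pdivrMr ?exprn_gt0// (mulrC _%:R e) -mulrA.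
rewrite ler_wpM2l ?(ltW e0)// -!natrX -natrM ler_nat mulnC.
exact: expn_le_ffact.
Qed.

End strong_law.

(** * The variance estimator *)

Section hypergeometric.
Context (R : realType).

Lemma hypergeom_ge0 n m c : 0 <= hypergeom R n m c.
Proof. by rewrite /hypergeom divr_ge0. Qed.

Lemma sum_hypergeom n m : (m <= n)%N -> \sum_(c < m.+1) hypergeom R n m c = 1.
Proof.
move=> mn; rewrite -mulr_suml -natr_sum binomial.Vandermonde subnKC// divff//.
by rewrite pnatr_eq0 -lt0n bin_gt0.
Qed.

(* n times the mean m ^ 2 / n of the hypergeometric law *)
Lemma mean_hypergeom n m : (0 < m)%N -> (m <= n)%N ->
  n%:R * \sum_(1 <= c < m.+1) c%:R * hypergeom R n m c = m%:R ^+ 2.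
Proof.
case: m => // m _; case: n => // n mn; rewrite ltnS in mn.
have C0 : 'C(n.+1, m.+1)%:R != 0 :> R by rewrite pnatr_eq0 -lt0n bin_gt0.
have -> : \sum_(1 <= c < m.+2) c%:R * hypergeom R n.+1 m.+1 c =
    (m.+1 * 'C(n, m))%:R / 'C(n.+1, m.+1)%:R :> R.
  rewrite big_add1/= big_mkord /hypergeom.
  under eq_bigr do rewrite mulrA -natrM.
  rewrite -mulr_suml -natr_sum; congr (_%:R / _).
  (* Absorbing the factor [c] into the binomial coefficient lowers both of its entries by one and
     leaves a Vandermonde sum. *)
  under eq_bigr do rewrite mulnA -mul_bin_diag -mulnA !subSS.
  by rewrite -big_distrr/= binomial.Vandermonde subnKC.
apply: (mulIf C0); rewrite mulrA divfK// -!natrM -natrX -natrM; congr (_%:R).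
by rewrite mulnCA mul_bin_diag mulnA mulnn.
Qed.

Lemma hypergeom_tail n m : (m <= n)%N ->
  1 - hypergeom R n m 0 = \sum_(1 <= c < m.+1) hypergeom R n m c.
Proof.
move=> mn; rewrite -[X in X - _](sum_hypergeom mn).
by rewrite -(big_mkord xpredT (hypergeom R n m)) big_ltn// addrAC subrr add0r.
Qed.

(** Markov's inequality: the mass of the values at least 1 is bounded by the mean. *)
Lemma hypergeom_tail_le n m : (0 < m)%N -> (m <= n)%N ->
  n%:R * (1 - hypergeom R n m 0) <= m%:R ^+ 2.
Proof.
move=> m0 mn; rewrite -(mean_hypergeom m0 mn) ler_wpM2l// hypergeom_tail//.
rewrite big_seq [leRHS]big_seq ler_sum// => c.
rewrite mem_index_iota => /andP[c1 _]; rewrite ler_peMl ?hypergeom_ge0//.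
by rewrite ler1n.
Qed.

Lemma hypergeom_le n m c : (0 < c)%N -> (c <= m)%N -> (m <= n)%N ->
  n%:R * hypergeom R n m c <= m%:R ^+ 2.
Proof.
move=> c0 cm mn; have m0 : (0 < m)%N by exact: leq_trans cm.
apply: le_trans (hypergeom_tail_le m0 mn); rewrite ler_wpM2l// hypergeom_tail//.
rewrite (bigD1_seq c)/= ?mem_index_iota ?c0 ?iota_uniq//.
by rewrite lerDl; apply: sumr_ge0 => i _; exact: hypergeom_ge0.
Qed.

End hypergeometric.

(** * Almost sure rate of the estimator *)

Section consistency.
Context d (T : measurableType d) (R : realType) (P : probability T R).

Lemma cvg0_sum (I : Type) (s : seq I) (F : I -> nat -> R) :
  (forall i, F i n @[n --> \oo] --> (0 : R)) ->
  \sum_(i <- s) F i n @[n --> \oo] --> (0 : R).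
Proof.
move=> F0; elim: s => [|i s IH].
  by under eq_fun do rewrite big_nil; exact: cvg_cst.
under eq_fun do rewrite big_cons.
have H : (F i n + \sum_(j <- s) F j n) @[n --> \oo] --> (0 + 0 : R).
  exact: cvgD (F0 i) IH.
by move: H; rewrite addr0.
Qed.

Context m (Psi : m.-tuple T -> R).
Hypothesis m0 : (0 < m)%N.
Hypothesis bPsi : ess_bounded (iid_law P m) Psi.
Hypothesis symPsi : symmetric_kernel Psi.

(** The error is a combination of the errors of the U-statistics, with coefficients of order
    [1 / n]; these absorb the factor [n ^ a] as long as [a <= 1]. *)
Lemma var_estimator_consistent d' (Omega : measurableType d')
    (Q : probability Omega R) (Z : nat -> Omega -> T) (a : R) :
  iid P Q Z -> a <= 1 ->
  {ae Q, forall w, (fun n => n%:R `^ a *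
     (var_estimator Psi [tuple Z i w | i < n] -
      fine ('V_(iid_law P n)[@Ustat_sym R T m n Psi])%E)) @ \oo --> (0 : R)}.
Proof.
move=> iidZ a1.
pose K c : R := \int[iid_law P (m + (m - c))]_z overlap Psi (c := c) z.
pose U c n w : R := Ustat (overlap Psi (c := c)) [tuple Z i w | i < n].
have : {ae Q, forall w, forall c, U c ^~ w @ \oo --> K c}.
  apply: ae_foralln => c; apply: (Ustat_strong_law iidZ).
    by rewrite addn_gt0 m0.
  exact: ess_bounded_overlap.
apply: filterS => w UK.
have UK0 c : `|U c n w - K c| @[n --> \oo] --> (0 : R).
  apply/norm_cvg0P.
  have H : (U c n w - K c) @[n --> \oo] --> (K c - K c : R).
    exact: cvgB (UK c) (cvg_cst _).
  by move: H; rewrite subrr.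
(* [b] majorizes the scaled error once [n >= m + m], where unbiasedness expresses the variance
   through the same coefficients as the estimator. *)
pose b n := m%:R ^+ 2 *
  (\sum_(1 <= c < m.+1) `|U c n w - K c| + `|U 0%N n w - K 0%N|).
have b0 : b n @[n --> \oo] --> (0 : R).
  have S0 := @cvg0_sum _ (index_iota 1 m.+1) (fun c n => `|U c n w - K c|) UK0.
  have H : b n @[n --> \oo] --> (m%:R ^+ 2 * (0 + 0) : R).
    exact: cvgM (cvg_cst _) (cvgD S0 (UK0 0%N)).
  by move: H; rewrite addr0 mulr0.
apply: norm_cvg0; apply: (squeeze_cvgr _ (cvg_cst 0) b0).
exists (m + m)%N => // n /= mn.
have m_n : (m <= n)%N by rewrite (leq_trans _ mn)// leq_addr.
have n1 : 1 <= n%:R :> R by rewrite ler1n (leq_trans m0).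
rewrite normr_ge0/=.
have -> : fine ('V_(iid_law P n)[@Ustat_sym R T m n Psi])%E =
    \sum_(1 <= c < m.+1) hypergeom R n m c * K c -
    (1 - hypergeom R n m 0) * K 0%N.
  rewrite -var_estimator_unbiased// ess_bounded_expectation/=; last first.
    exact: ess_bounded_var_estimator.
  exact: Rintegral_var_estimator.
have -> : var_estimator Psi [tuple Z i w | i < n] -
    (\sum_(1 <= c < m.+1) hypergeom R n m c * K c -
     (1 - hypergeom R n m 0) * K 0%N) =
    \sum_(1 <= c < m.+1) hypergeom R n m c * (U c n w - K c) -
    (1 - hypergeom R n m 0) * (U 0%N n w - K 0%N).
  under [in RHS]eq_bigr do rewrite mulrBr.
  rewrite sumrB mulrBr /var_estimator -/(U _ _ _) !opprB; ring.
have powa : `|n%:R `^ a| <= n%:R :> R.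
  by rewrite ger0_norm ?powR_ge0// -[leRHS]powRr1// ler_powR.
rewrite normrM; apply: le_trans (ler_wpM2r (normr_ge0 _) powa) _.
have h1 : 0 <= 1 - hypergeom R n m 0.
  by rewrite hypergeom_tail//; apply: sumr_ge0 => i _; exact: hypergeom_ge0.
apply: le_trans (ler_wpM2l (ler0n _ _) (ler_normB _ _)) _.
rewrite mulrDr /b [leRHS]mulrDr lerD//; last first.
  by rewrite normrM ger0_norm// mulrA ler_wpM2r// hypergeom_tail_le.
apply: le_trans (ler_wpM2l (ler0n _ _) (ler_norm_sum _ _ _)) _.
rewrite !mulr_sumr big_seq [leRHS]big_seq ler_sum// => c.
rewrite mem_index_iota => /andP[c1 cm].
by rewrite normrM ger0_norm ?hypergeom_ge0// mulrA ler_wpM2r// hypergeom_le.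
Qed.

End consistency.

(** * Least variance among unbiased estimators *)

Section optimal_variance.
Context d (T : measurableType d) (R : realType).
Context m (Psi : m.-tuple T -> R).
Hypothesis measurable1 : forall x : T, measurable [set x].
Hypothesis mPsi : measurable_fun setT Psi.
Variable Pfam : set (probability T R).
Hypothesis Pfam_atomic :
  forall P : probability T R, purely_discontinuous P -> Pfam P.

Lemma measurable_Ustat k n (h : k.-tuple T -> R) :
  measurable_fun setT h -> measurable_fun setT (@Ustat R T k n h).
Proof.
move=> mh; apply: measurable_funM; first exact: measurable_cst.
under eq_fun do rewrite -big_filter; apply: measurable_sum => s.
exact: measurableT_comp mh (measurable_subtuple s).
Qed.

Lemma measurable_var_estimator n :
  measurable_fun setT (@var_estimator R T m n Psi).
Proof.
have mU c : measurable_fun setT (@Ustat R T _ n (overlap Psi (c := c))).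
  apply: measurable_Ustat; apply: measurable_funM;
  exact: measurableT_comp mPsi (measurable_subtuple _).
apply: measurable_funB; last by apply: measurable_funM.
by apply: measurable_sum => c; apply: measurable_funM.
Qed.

Lemma var_estimator_subtuple n (p : 'I_n -> 'I_n) z : injective p ->
  var_estimator Psi (subtuple p z) = var_estimator Psi z.
Proof.
move=> inj_p; rewrite /var_estimator Ustat_subtuple//; congr (_ - _).
by apply: eq_bigr => c _; rewrite Ustat_subtuple.
Qed.

Lemma var_estimator_optimal n (S : n.-tuple T -> R) : (0 < n)%N ->
  measurable_fun setT S ->
  (forall P, Pfam P -> 'E_(iid_law P n)[S] =
     'E_(iid_law P n)[@var_estimator R T m n Psi])%E ->
  forall P, Pfam P ->
    ('V_(iid_law P n)[@var_estimator R T m n Psi] <= 'V_(iid_law P n)[S])%E.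
Proof.
move=> n0 mS ES P FP.
have vE : @var_estimator R T m n Psi = Ustat S.
  apply/funext => z; rewrite -(@Ustat_id d T R n (@var_estimator R T m n Psi));
    last by move=> p; exact: var_estimator_subtuple.
  congr (_ * _); apply: esym.
  exact: (unbiased_eq_sum_injective n0 measurable1 Pfam_atomic mS
    (@measurable_var_estimator n) ES).
by rewrite vE; apply: variance_Ustat_le => //; rewrite -vE ES.
Qed.

End optimal_variance.

(** * Measurability, boundedness and symmetry of the loss difference kernel *)

Section loss_difference_kernel.
Context d1 d2 (X : measurableType d1) (Y : measurableType d2) (R : realType).
Context (L : Y * Y -> R) (g : nat) (f f' : g.-tuple (X * Y) * X -> Y).

(** The permutation sends the last position to [i] and keeps the order of the others; almost sure
    boundedness assumed for the last test position thus passes to every other one. *)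
Lemma Phi_test_subtuple (i : 'I_g.+1) z :
  Phi_test L f f' i z =
  Phi_test L f f' ord_max (subtuple (lift_perm ord_max i 1) z).
Proof.
rewrite /Phi_test tnth_mktuple lift_perm_id subtuple_comp; congr Phi.
by apply: eq_subtuple => j /=; rewrite lift_perm_lift perm1.
Qed.

Lemma measurable_Phi_test i :
  measurable_fun setT L -> measurable_fun setT f -> measurable_fun setT f' ->
  measurable_fun setT (Phi_test L f f' i).
Proof.
move=> mL mf mf'.
have mi : measurable_fun setT (fun z : g.+1.-tuple (X * Y) => tnth z i).
  exact: measurable_tnth.
have mh (h : g.-tuple (X * Y) * X -> Y) : measurable_fun setT h ->
    measurable_fun setT (fun z : g.+1.-tuple (X * Y) =>
      L (h (subtuple (lift i) z, (tnth z i).1), (tnth z i).2)).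
  move=> mh; apply: (measurableT_comp mL); apply: measurable_fun_pair.
    apply: (measurableT_comp mh); apply: measurable_fun_pair.
      exact: measurable_subtuple.
    exact: measurableT_comp measurable_fst mi.
  exact: measurableT_comp measurable_snd mi.
by apply: measurable_funB; exact: mh.
Qed.

Lemma measurable_Phi0 :
  measurable_fun setT L -> measurable_fun setT f -> measurable_fun setT f' ->
  measurable_fun setT (Phi0 L f f').
Proof.
move=> mL mf mf'; apply: measurable_funM; first exact: measurable_cst.
by apply: measurable_sum => i; exact: measurable_Phi_test.
Qed.

Lemma ess_bounded_Phi0 (P : probability (X * Y)%type R) :
  ess_bounded (iid_law P g.+1) (Phi_test L f f' ord_max) ->
  ess_bounded (iid_law P g.+1) (Phi0 L f f').
Proof.
move=> bPhi; apply: ess_boundedZ; apply: ess_bounded_sum => i _.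
rewrite (funext (Phi_test_subtuple i)).
exact/ess_bounded_subtuple/bPhi/perm_inj.
Qed.

(** A permutation [s] carries the test position [i] to [s i]; the training points remain the same
    and only change their order, which [f] and [f'] ignore. *)
Lemma Phi0_symmetric :
  (forall (s : 'S_g) z x, f (subtuple s z, x) = f (z, x)) ->
  (forall (s : 'S_g) z x, f' (subtuple s z, x) = f' (z, x)) ->
  symmetric_kernel (Phi0 L f f').
Proof.
move=> sf sf' s z; congr (_ * _).
rewrite [RHS](reindex_perm s)/=; apply: eq_bigr => i _.
have imE (u : 'I_g -> 'I_g.+1) : injective u -> (forall j, u j != s i) ->
    [set u j | j : 'I_g]%SET = [set~ s i]%SET.
  move=> inj_u uNi; apply/eqP; rewrite eqEcard; apply/andP; split.
    by apply/fintype.subsetP => _ /imsetP[j _ ->]; rewrite !inE uNi.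
  by rewrite cardsC1 !card_ord/= card_imset// card_ord.
have inj1 : injective (s \o lift i) by exact/inj_comp/lift_inj/perm_inj.
have inj2 : injective (lift (s i)) by exact: lift_inj.
have [|p pE] := injective_imset_perm inj1 inj2.
  rewrite !imE// => j; first by rewrite eq_sym neq_lift.
  by rewrite /= (inj_eq perm_inj) eq_sym neq_lift.
rewrite /Phi_test tnth_mktuple subtuple_comp (eq_subtuple _ pE) -subtuple_comp.
by rewrite /Phi sf sf'.
Qed.

End loss_difference_kernel.

Lemma measurable_tuple1 d (T : measurableType d) n (z : n.-tuple T) :
  (forall x : T, measurable [set x]) -> measurable [set z].
Proof.
move=> m1; rewrite (_ : [set z] = box (fun i => [set tnth z i])).
  exact: measurable_box.
apply/seteqP; split => [_ ->//|y yz].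
by apply: eq_from_tnth => i; exact: yz.
Qed.

Lemma measurable_response1 (R : realType) (Y : set R) (Y0 : Y !=set0)
  (y : response Y0) : measurable [set y].
Proof.
exists [set subreal_val (Y0 := Y0) y]; first exact: measurable_set1.
by apply/seteqP; split => [x [_] /val_inj|_ ->].
Qed.

Theorem theorem3p9 (R : realType) (r : nat) (r_gt0 : (0 < r)%N)
  (Y : set R) (Y0 : Y !=set0)
  (L : response Y0 * response Y0 -> R) (mL : measurable_fun setT L)
  (g : nat)
  (fM fM' : g.-tuple (predictor R r * response Y0) * predictor R r -> response Y0)
  (mfM : measurable_fun setT fM) (mfM' : measurable_fun setT fM')
  (sym_fM : forall (s : 'S_g) z x, fM (subtuple s z, x) = fM (z, x))
  (sym_fM' : forall (s : 'S_g) z x, fM' (subtuple s z, x) = fM' (z, x))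
  (Pfam : set (probability (predictor R r * response Y0)%type R))
  (Pfam_marginal : forall P, Pfam P -> purely_discontinuous (pushforward P snd))
  (Pfam_atomic : forall P : probability (predictor R r * response Y0)%type R,
     purely_discontinuous P -> Pfam P)
  (Phi_bounded : forall P, Pfam P ->
     exists B : R, {ae iid_law P g.+1,
       forall z, `|Phi_test L fM fM' ord_max z| <= B})
  (degree_kappa : forall c, (1 <= c <= g.+1)%N ->
     has_degree Pfam (kappa (Phi0 L fM fM') c) (2 * g + 2 - c)%N)
  (degree_sq : has_degree Pfam (squared_mean (Phi0 L fM fM')) (2 * g + 2)%N) :
  (forall n, (2 * g + 2 <= n)%N ->
     let Delta_hat := @Ustat_sym R _ g.+1 n (Phi0 L fM fM') in
     let v_hat := @var_estimator R _ g.+1 n (Phi0 L fM fM') in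
     (forall P, Pfam P ->
        'E_(iid_law P n)[v_hat] = 'V_(iid_law P n)[Delta_hat])%E /\
     (forall T : n.-tuple (predictor R r * response Y0) -> R,
        measurable_fun setT T ->
        (forall P, Pfam P ->
           'E_(iid_law P n)[T] = 'V_(iid_law P n)[Delta_hat])%E ->
        forall P, Pfam P ->
          ('V_(iid_law P n)[v_hat] <= 'V_(iid_law P n)[T])%E))
  /\
  (forall P, Pfam P ->
   forall (disp : measure_display) (Omega : measurableType disp)
     (Q : probability Omega R)
     (Z : nat -> Omega -> predictor R r * response Y0),
   iid P Q Z ->
   forall d : R, 0 <= d <= 2 ->
     {ae Q, forall w,
       (fun n => n%:R `^ (d / 2) *
          (@var_estimator R _ g.+1 n (Phi0 L fM fM') [tuple Z i w | i < n] -
           fine ('V_(iid_law P n)[@Ustat_sym R _ g.+1 n (Phi0 L fM fM')])%E))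
       @ \oo --> (0 : R)}).
Proof.
set Psi := Phi0 L fM fM'.
have gm : (2 * g + 2 = g.+1 + g.+1)%N by rewrite mul2n -addnn addn2 addSn addnS.
have mPsi : measurable_fun setT Psi by exact: measurable_Phi0.
have symPsi : symmetric_kernel Psi by exact: Phi0_symmetric.
have bPsi P : Pfam P -> ess_bounded (iid_law P g.+1) Psi.
  move=> FP; apply: ess_bounded_Phi0; split; last exact: Phi_bounded.
  exact: measurable_Phi_test.
(* Measurable singletons let finitely supported test laws qualify as purely discontinuous; they are
   checked on predictor and response separately. *)
have measurable1 (z : (predictor R r * response Y0)%type) : measurable [set z].
  have -> : [set z] = [set z.1] `*` [set z.2].
    by apply/seteqP; split => [_ ->//|[x y] [/= -> ->]]; case: z.
  apply: measurableX; last exact: measurable_response1.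
  by apply: measurable_tuple1 => x; exact: measurable_set1.
split=> [n gn|P FP disp Omega Q Z iidZ a /andP[_ a2]].
  rewrite gm in gn.
  have unbiased P : Pfam P -> ('E_(iid_law P n)[@var_estimator R _ g.+1 n Psi] =
      'V_(iid_law P n)[@Ustat_sym R _ g.+1 n Psi])%E.
    by move=> FP; apply: var_estimator_unbiased => //; exact: bPsi.
  split=> // S mS ES P FP.
  apply: (var_estimator_optimal measurable1 mPsi Pfam_atomic) => //.
    by rewrite (leq_trans _ gn).
  by move=> P' FP'; rewrite ES// unbiased.
apply: var_estimator_consistent => //; first exact: bPsi.
by rewrite ler_pdivrMr// mul1r.
Qed.
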